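(* Let $T:X\longrightarrow X$ be an operator acting on a Fréchet space $(X,d)$. Then: (a) If $\operatorname{span}(NS(T))$ is dense in $X$, then the following statements are equivalent: (i) the system $(X,T)$ is not equicontinuous; (ii) the system $(X,T)$ is U-LYC for the metric $d$; (iii) the system $(\mathcal{K}(X),\overline{T})$ is U-LYC for the metric $d_H$; (iv) the system $(\mathcal{F}_\infty(X),\hat{T})$ is U-LYC; (v) the system $(\mathcal{F}_0(X),\hat{T})$ is U-LYC; (vi) the system $(\mathcal{F}_S(X),\hat{T})$ is U-LYC; (vii) the system $(\mathcal{F}_E(X),\hat{T})$ is U-LYC. (b) If the set $X_0:=\{x\in X: T^{n_k}x\to 0_X \text{ as } k\to\infty\}$ is dense in $X$ for some increasing sequence of positive integers $(n_k)_{k\in\mathbb{N}}$, then the following statements are equivalent: (i) the system $(X,T)$ is not equicontinuous; (ii) the system $(X,T)$ is CD-LYC for the metric $d$; (iii) the system $(\mathcal{K}(X),\overline{T})$ is CD-LYC for the metric $d_H$; (iv) the system $(\mathcal{F}_\infty(X),\hat{T})$ is CD-LYC; (v) the system $(\mathcal{F}_0(X),\hat{T})$ is CD-LYC; (vi) the system $(\mathcal{F}_S(X),\hat{T})$ is U-LYC; (vii) the system $(\mathcal{F}_E(X),\hat{T})$ is U-LYC.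
   Context: Notation: $\mathbb{N}=\{1,2,3,\dots\}$, $\mathbb{I}=[0,1]$. **Linear dynamics.** A Fréchet space $(X,d)$ is a locally convex topological vector space $X$ with a (compatible) translation-invariant metric $d$ for which $(X,d)$ is complete; $0_X$ is its zero vector. An operator is a continuous linear map $T:X\to X$. $NS(T):=\{x\in X: (T^n(x))_n \text{ admits a subsequence converging to } 0_X\}$, and $\operatorname{span}(E)$ is the linear span of $E$. $(X,T)$ is equicontinuous if for each $\varepsilon>0$ there is $\delta>0$ such that $d(x,y)<\delta$ implies $d(T^n(x),T^n(y))<\varepsilon$ for all $n\in\mathbb{N}$. **Chaos notions.** Let $g:Y\to Y$ be a continuous map on a metric space $(Y,\rho)$. For $\varepsilon>0$, a set $S\subset Y$ is Li-Yorke (LY) $\varepsilon$-scrambled (for $g$ and $\rho$) if for every pair of distinct points $x,y\in S$ one has $\limsup_{n\to\infty}\rho(g^n(x),g^n(y))\geq\varepsilon$ and $\liminf_{n\to\infty}\rho(g^n(x),g^n(y))=0$. $(Y,g)$ is uniformly Li-Yorke chaotic (U-LYC) for $\rho$ if there is an uncountable LY $\varepsilon$-scrambled set $S\subset Y$ for some $\varepsilon>0$. A Cantor set is a set homeomorphic to the classical Cantor ternary set. $(Y,g)$ is Cantor-densely Li-Yorke chaotic (CD-LYC) for $\rho$ if there exists $\varepsilon>0$ such that for any sequence $(U_j)_{j\in\mathbb{N}}$ of non-empty open subsets of $Y$ there is a sequence of Cantor sets $(K_j)_{j\in\mathbb{N}}$ in $Y$ with $K_j\subset U_j$ for all $j$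 and such that $\bigcup_{j\in\mathbb{N}}K_j$ is LY $\varepsilon$-scrambled for $g$ and $\rho$. **Hyperspaces.** $\mathcal{K}(X)$ is the set of non-empty compact subsets of $X$. For non-empty closed sets $C_1,C_2$, $d_H(C_1,C_2):=\max\{\sup_{x_1\in C_1}\inf_{x_2\in C_2}d(x_1,x_2),\ \sup_{x_2\in C_2}\inf_{x_1\in C_1}d(x_2,x_1)\}$ (Hausdorff metric on $\mathcal{K}(X)$). $\overline{T}:\mathcal{K}(X)\to\mathcal{K}(X)$ is $\overline{T}(K):=T(K)$. **Fuzzy sets.** $\mathcal{F}(X)$ is the set of upper-semicontinuous functions $u:X\to\mathbb{I}$ such that $u_0:=\overline{\{x: u(x)>0\}}$ is compact and $u_1\neq\varnothing$, where $u_\alpha:=\{x: u(x)\geq\alpha\}$ for $\alpha\in\,]0,1]$. The Zadeh extension $\hat{T}:\mathcal{F}(X)\to\mathcal{F}(X)$ is $[\hat{T}(u)](x):=\sup\{u(y): y\in T^{-1}(\{x\})\}$ if $T^{-1}(\{x\})\neq\varnothing$, and $0$ otherwise (it is well defined and continuous for all metrics below). Metrics on $\mathcal{F}(X)$: - $d_\infty(u,v):=\sup_{\alpha\in\mathbb{I}}d_H(u_\alpha,v_\alpha)$; - $d_0(u,v):=\inf\{\varepsilon>0:$ there is a strictly increasing homeomorphism $\xi:\mathbb{I}\to\mathbb{I}$ with $\sup_{\alpha\in\mathbb{I}}|\xi(\alpha)-\alpha|\leq\varepsilon$ and $d_\infty(u,\xi\circ v)\leq\varepsilon\}$; - on $X\times\mathbb{I}$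 let $\overline{d}((x,\alpha),(y,\beta)):=\max\{d(x,y),|\alpha-\beta|\}$, and let $\operatorname{end}(u):=\{(x,\alpha)\in X\times\mathbb{I}: u(x)\geq\alpha\}$, $\operatorname{send}(u):=\operatorname{end}(u)\cap(u_0\times\mathbb{I})$. Then $d_S(u,v)$ is the Hausdorff distance (induced by $\overline{d}$) between $\operatorname{send}(u)$ and $\operatorname{send}(v)$, and $d_E(u,v)$ is the Hausdorff distance (induced by $\overline{d}$) between $\operatorname{end}(u)$ and $\operatorname{end}(v)$. $\mathcal{F}_\infty(X),\mathcal{F}_0(X),\mathcal{F}_S(X),\mathcal{F}_E(X)$ denote $\mathcal{F}(X)$ with the metric $d_\infty,d_0,d_S,d_E$ respectively; chaos of these systems is meant with respect to the corresponding metric. *)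

(* Defs.v *)
From HB Require Import structures.
From mathcomp Require Import all_boot all_order all_algebra.
From mathcomp Require Import complex lra.
From mathcomp Require Import all_classical all_reals all_analysis.

Set Implicit Arguments.
Unset Strict Implicit.
Unset Printing Implicit Defensive.

Import Order.TTheory GRing.Theory Num.Theory.
Import numFieldNormedType.Exports.

Local Open Scope classical_set_scope.
Local Open Scope ring_scope.

(* The uniform structure carried by a [tvsType] is only required to induce its
   topology, so completeness is stated for the metric [d] itself. *)
Record frechet_metric (R : realType) (K : numFieldType) (X : tvsType K)
    (d : X -> X -> R) : Prop := FrechetMetric {
  fmetric_ge0 : forall x y, 0 <= d x y ;
  fmetric_eq0 : forall x y, d x y = 0 <-> x = y ;
  fmetric_sym : forall x y, d x y = d y x ;
  fmetric_triangle : forall x y z, d x z <= d x y + d y z ;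
  fmetric_translation : forall x y z, d (x + z) (y + z) = d x y ;
  fmetric_nbhs : forall (x : X) (A : set X),
    nbhs x A <-> exists2 e : R, 0 < e & [set y | d x y < e] `<=` A ;
  fmetric_complete : forall u : nat -> X,
    (forall e : R, 0 < e -> exists N : nat, forall m n : nat,
      (N <= m)%N -> (N <= n)%N -> d (u m) (u n) < e) ->
    exists l : X, u @ \oo --> l }.

Definition increasing_positive (s : nat -> nat) : Prop :=
  (forall k, (0 < s k)%N) /\ {homo s : i j / (i < j)%N}.

Definition NS (K : numFieldType) (X : tvsType K) (T : X -> X) : set X :=
  [set x | exists2 s : nat -> nat, increasing_positive s &
           (fun k => iter (s k) T x) @ \oo --> (0 : X)].

Definition linear_span (K : numFieldType) (X : lmodType K) (E : set X) : set X :=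
  [set x | exists (n : nat) (a : 'I_n -> K) (v : 'I_n -> X),
           (forall i, E (v i)) /\ x = \sum_(i < n) a i *: v i].

Definition equicontinuous_system (R : realType) (Y : Type) (rho : Y -> Y -> R)
    (g : Y -> Y) : Prop :=
  forall e : R, 0 < e -> exists2 delta : R, 0 < delta &
    forall x y, rho x y < delta ->
      forall n, (0 < n)%N -> rho (iter n g x) (iter n g y) < e.

(* The upper limit may be +oo when [rho] is unbounded, hence the use of
   extended reals. *)
Definition li_yorke_scrambled (R : realType) (Y : Type) (rho : Y -> Y -> R)
    (g : Y -> Y) (e : R) (S : set Y) : Prop :=
  forall x y, S x -> S y -> x <> y ->
    (e%:E <= limn_esup (fun n => (rho (iter n g x) (iter n g y))%:E))%E /\
    limn_einf (fun n => (rho (iter n g x) (iter n g y))%:E) = 0%E.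

Definition U_LYC (R : realType) (Y : Type) (rho : Y -> Y -> R) (g : Y -> Y)
    : Prop :=
  exists e : R, 0 < e /\
    exists S : set Y, ~ countable S /\ li_yorke_scrambled rho g e S.

Definition metric_open (R : realType) (Y : Type) (rho : Y -> Y -> R)
    (U : set Y) : Prop :=
  forall x, U x -> exists2 r : R, 0 < r & [set y | rho x y < r] `<=` U.

Definition metric_continuous_on (R : realType) (Y Z : Type)
    (rhoY : Y -> Y -> R) (rhoZ : Z -> Z -> R) (A : set Y) (f : Y -> Z) : Prop :=
  forall x, A x -> forall e : R, 0 < e -> exists2 delta : R, 0 < delta &
    forall y, A y -> rhoY x y < delta -> rhoZ (f x) (f y) < e.

Definition dist_real (R : realType) (a b : R) : R := `|a - b|.

Fixpoint ternary_step (R : realType) (n : nat) : set R :=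
  if n is m.+1 then
    [set x / 3 | x in @ternary_step R m] `|`
    [set (x + 2) / 3 | x in @ternary_step R m]
  else `[0, 1].

Definition ternary_set (R : realType) : set R :=
  \bigcap_(n in [set: nat]) @ternary_step R n.

Definition cantor_set (R : realType) (Y : Type) (rho : Y -> Y -> R)
    (C : set Y) : Prop :=
  exists (f : R -> Y) (h : Y -> R),
    [/\ f @` @ternary_set R = C,
        (forall t, @ternary_set R t -> h (f t) = t),
        metric_continuous_on (@dist_real R) rho (@ternary_set R) f
      & metric_continuous_on rho (@dist_real R) C h].

Definition CD_LYC (R : realType) (Y : Type) (rho : Y -> Y -> R) (g : Y -> Y)
    : Prop :=
  exists e : R, 0 < e /\
    forall U : nat -> set Y,
      (forall j, metric_open rho (U j) /\ U j !=set0) ->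
      exists C : nat -> set Y,
        (forall j, cantor_set rho (C j) /\ C j `<=` U j) /\
        li_yorke_scrambled rho g e (\bigcup_(j in [set: nat]) C j).

(* [sup] and [inf] are real-valued and default to 0; every supremum and infimum
   below is taken over a nonempty set bounded on the relevant side. *)
Definition hausdorff_dist (R : realType) (Y : Type) (rho : Y -> Y -> R)
    (A B : set Y) : R :=
  Num.max (sup [set inf [set rho a b | b in B] | a in A])
          (sup [set inf [set rho b a | a in A] | b in B]).

Definition hyperspace (X : topologicalType) : Type :=
  {A : set X | compact A /\ A !=set0}.

Definition hyper_dist (R : realType) (X : topologicalType) (d : X -> X -> R)
    (A B : hyperspace X) : R := hausdorff_dist d (sval A) (sval B).

Lemma hyper_map_subproof (X : topologicalType) (T : X -> X)
    (hT : continuous T) (A : hyperspace X) :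
  compact (T @` sval A) /\ T @` sval A !=set0.
Proof.
case: A => A /= [cA [a Aa]]; split; last by exists (T a), a.
by apply: continuous_compact => //; exact: continuous_subspaceT.
Qed.

Definition hyper_map (X : topologicalType) (T : X -> X) (hT : continuous T)
    (A : hyperspace X) : hyperspace X :=
  exist _ (T @` sval A) (hyper_map_subproof hT A).

Definition upper_semicontinuous (R : realType) (X : topologicalType)
    (u : X -> R) : Prop :=
  forall (x : X) (a : R), u x < a -> \forall y \near x, u y < a.

Definition level (R : realType) (X : topologicalType) (u : X -> R) (a : R)
    : set X :=
  if a == 0 then closure [set x | 0 < u x] else [set x | a <= u x].

Definition is_fuzzy (R : realType) (X : topologicalType) (u : X -> R) : Prop :=
  [/\ forall x, 0 <= u x <= 1, upper_semicontinuous u,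
      compact (level u 0) & level u 1 !=set0].

Definition fuzzy (R : realType) (X : topologicalType) : Type :=
  {u : X -> R | is_fuzzy u}.

Definition zadeh (R : realType) (X : topologicalType) (T : X -> X)
    (u : X -> R) (x : X) : R :=
  if `[< T @^-1` [set x] !=set0 >] then sup [set u y | y in T @^-1` [set x]]
  else 0.

Section ZadehWellDefined.
Context (R : realType) (X : topologicalType).
Implicit Types (T : X -> X) (u : X -> R).

Lemma level_pos u (a : R) : 0 < a -> level u a = [set x | a <= u x].
Proof. by move=> a0; rewrite /level gt_eqF. Qed.

Lemma level_closed u (a : R) :
  upper_semicontinuous u -> closed [set x | a <= u x].
Proof.
move=> us x cx /=; rewrite leNgt; apply/negP => xa.
by have [y [/= ay]] := cx _ (us _ _ xa); rewrite ltNge ay.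
Qed.

Lemma level_compact u (a : R) :
  is_fuzzy u -> 0 < a -> compact [set x | a <= u x].
Proof.
move=> [_ us c0 _] a0; apply: (subclosed_compact (level_closed us) c0).
rewrite /level eqxx => x /= ax; apply: subset_closure => /=.
exact: lt_le_trans ax.
Qed.

Lemma zadeh_level T u (a : R) : hausdorff_space X -> continuous T ->
  is_fuzzy u -> 0 < a ->
  [set x | a <= zadeh T u x] = T @` [set x | a <= u x].
Proof.
move=> hX hT fu a0; have [u01 us c0 c1] := fu.
have hs x : has_ubound [set u y | y in T @^-1` [set x]].
  by exists 1 => _ [y _ <-]; have /andP[] := u01 y.
apply/seteqP; split=> [x /=|_ [y /= ay <-]]; last first.
  rewrite /zadeh; case: asboolP => [_|]; last by case; exists y.
  by apply: (le_trans ay); apply: ub_le_sup; [exact: hs | exists y].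
rewrite /zadeh; case: asboolP => [[y0 Ty0]|_]; last by rewrite leNgt a0.
set E := [set u y | y in _]; set s := sup E => sa.
have s0 : 0 < s by exact: lt_le_trans sa.
have supE : has_sup E by split; [exists (u y0), y0 | exact: hs].
have /choice[f fP] : forall n : nat,
    exists y, T y = x /\ s - s / 2 / n.+1%:R < u y.
  move=> n; have e0 : 0 < s / 2 / n.+1%:R by rewrite !divr_gt0.
  by have [_ [y Ty <-] ?] := sup_adherent e0 supE; exists y.
have cC : compact [set y | s / 2 <= u y] by apply: level_compact; rewrite ?divr_gt0.
have fC : \forall n \near \oo, s / 2 <= u (f n).
  near=> n => /=; have [_ fn] := fP n; apply: ltW; apply: le_lt_trans fn.
  have hn : s / 2 / n.+1%:R <= s / 2.
    by rewrite ler_pdivrMr// ler_peMr ?ler1n// ltW// divr_gt0.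
  by move: hn; set z := s / 2 / n.+1%:R; clearbody z s; lra.
have [y [/= sy cy]] := cC (f @ \oo) _ fC.
have Ty : T y = x.
  have clx : closed (T @^-1` [set x]).
    apply: preimage_closed => [z _|]; first exact: hT.
    exact: (accessible_closed_set1 (hausdorff_accessible hX)).
  apply: clx => V Vy; apply: (cy (T @^-1` [set x]) V) => //.
  have fx : \forall n \near \oo, T (f n) = x.
    by apply: nearW => n; have [] := fP n.
  exact: fx.
exists y => //=; apply: (le_trans sa); rewrite leNgt; apply/negP => ys.
pose b := (u y + s) / 2.
have yb : u y < b by rewrite midf_lt.
have bs : b < s by rewrite midf_lt.
have fb : \forall n \near \oo, b < u (f n).
  near=> n => /=; have [_ fn] := fP n; apply: le_lt_trans fn.
  have hn : s / 2 / n.+1%:R <= s - b.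
    rewrite ler_pdivrMr// -ler_pdivrMl ?subr_gt0// mulrC.
    apply: (@le_trans _ _ n%:R); last by rewrite ler_nat.
    by near: n; exact: nbhs_infty_ger.
  by move: hn; set z := s / 2 / n.+1%:R; clearbody z s; lra.
have [z [/= bz]] := cy [set z | b < u z] _ fb (us _ _ yb).
by rewrite ltNge (ltW bz).
Unshelve. all: by end_near. Qed.

Lemma zadeh_fuzzy T u : hausdorff_space X -> continuous T -> is_fuzzy u ->
  is_fuzzy (zadeh T u).
Proof.
move=> hX hT fu; have [u01 us c0 c1] := fu.
have Z01 x : 0 <= zadeh T u x <= 1.
  rewrite /zadeh; case: asboolP => [[y0 Ty0]|_]; last by rewrite lexx ler01.
  have ub1 : ubound [set u y | y in T @^-1` [set x]] 1.
    by move=> _ [y _ <-]; have /andP[] := u01 y.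
  apply/andP; split; last by apply: ge_sup => //; exists (u y0), y0.
  have /andP[u0 _] := u01 y0.
  by apply: (le_trans u0); apply: ub_le_sup; [exists 1 | exists y0].
have cT A : compact A -> compact (T @` A).
  by move=> cA; apply: continuous_compact => //; exact: continuous_subspaceT.
split=> //.
- move=> x a Zxa; have a0 : 0 < a.
    by apply: le_lt_trans Zxa; have /andP[] := Z01 x.
  have : closed [set y | a <= zadeh T u y].
    by rewrite zadeh_level//; apply: compact_closed => //; apply: cT; exact: level_compact.
  move=> /closed_openC cl; near=> y; rewrite ltNge; apply/negP; near: y.
  by apply: open_nbhs_nbhs; split => //=; apply/negP; rewrite -ltNge.
- have c0' := cT _ c0; apply: (subclosed_compact _ c0').
    by rewrite /level eqxx; exact: closed_closure.
  have cl : closed (T @` level u 0) by exact: compact_closed.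
  rewrite [X in X `<=` _]/level eqxx; apply: (subset_trans _ cl).
  apply: closureS => x /= Zx.
  have : [set z | zadeh T u x <= zadeh T u z] x by exact: lexx.
  rewrite zadeh_level// => -[y /= uy <-]; exists y => //.
  by rewrite /level eqxx; apply: subset_closure => /=; exact: lt_le_trans uy.
- move: c1; rewrite !level_pos// zadeh_level// => -[y y1].
  by exists (T y), y.
Unshelve. all: by end_near. Qed.

End ZadehWellDefined.

Lemma frechet_hausdorff (R : realType) (K : numFieldType) (X : tvsType K)
    (d : X -> X -> R) : frechet_metric d -> hausdorff_space X.
Proof.
move=> hd p q pq; apply/(fmetric_eq0 hd)/eqP.
rewrite eq_le (fmetric_ge0 hd) andbT leNgt; apply/negP => dpq.
have e0 : 0 < d p q / 2 by rewrite divr_gt0.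
have nb (x : X) : nbhs x [set y | d x y < d p q / 2].
  by apply/(fmetric_nbhs hd); exists (d p q / 2).
have [z [/= pz qz]] := pq _ _ (nb p) (nb q).
have := fmetric_triangle hd p z q; rewrite (fmetric_sym hd z q) leNgt.
by rewrite [ltRHS]splitr ltrD.
Qed.

Definition zadeh_map (R : realType) (X : topologicalType) (T : X -> X)
    (hX : hausdorff_space X) (hT : continuous T) (u : fuzzy R X) : fuzzy R X :=
  exist _ (zadeh T (sval u)) (zadeh_fuzzy hX hT (svalP u)).

Definition increasing_homeo (R : realType) (xi : R -> R) : Prop :=
  {in `[0, 1] &, {homo xi : a b / a < b}} /\
  exists zeta : R -> R,
    [/\ (forall a, a \in `[0, 1] -> xi a \in `[0, 1] /\ zeta (xi a) = a),
        (forall a, a \in `[0, 1] -> zeta a \in `[0, 1] /\ xi (zeta a) = a),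
        {within `[0, 1], continuous xi} & {within `[0, 1], continuous zeta}].

Section FuzzyMetrics.
Context (R : realType) (X : topologicalType) (d : X -> X -> R).
Implicit Types u v : X -> R.

Definition d_infty u v : R :=
  sup [set hausdorff_dist d (level u a) (level v a) | a in `[0, 1]].

Definition d_0 u v : R :=
  inf [set e : R | 0 < e /\ exists xi : R -> R,
    [/\ increasing_homeo xi,
        sup [set `|xi a - a| | a in `[0, 1]] <= e
      & d_infty u (xi \o v) <= e]].

Definition dbar (p q : X * R) : R := Num.max (d p.1 q.1) `|p.2 - q.2|.

Definition endograph u : set (X * R) :=
  [set p | 0 <= p.2 <= 1 /\ p.2 <= u p.1].

Definition sendograph u : set (X * R) :=
  endograph u `&` (level u 0 `*` `[0, 1]).

Definition d_S u v : R := hausdorff_dist dbar (sendograph u) (sendograph v).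

Definition d_E u v : R := hausdorff_dist dbar (endograph u) (endograph v).

Definition fuzzy_dist (D : (X -> R) -> (X -> R) -> R) (u v : fuzzy R X) : R :=
  D (sval u) (sval v).

End FuzzyMetrics.

(* Main.v *)
Require Import Defs.
From HB Require Import structures.
From mathcomp Require Import all_boot all_order all_algebra.
From mathcomp Require Import complex lra.
From mathcomp Require Import all_classical all_reals all_analysis.

(** Equicontinuity rules out every form of chaos considered here: once two orbits
    of an equicontinuous system come close they stay close, so no Li-Yorke pair
    exists.  It passes from [T] to the hyperspace and to the fuzzy extensions for
    all four metrics, because the positive level sets of the image of a fuzzy set
    are the images of its level sets.  What remains is to produce chaos in each
    system when [T] is not equicontinuous.

    The first step finds an increasing sequence [p] for which [T] already fails
    to be equicontinuous at the origin on the space of vectors that are null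
    along [p], that is, whose iterates at the times [p k] tend to [0]
    ([expanding_of_dense], [expanding_of_dense_span]).

    The core is one linear construction, [scrambled_family_exists].  It produces
    vectors [z j s], indexed by an integer [j] and a binary sequence [s], as sums
    of series whose [k]-th term is [c k j s *: y k], where the coefficient lies
    in the unit interval and depends only on [j] and on the first bits of [s].
    The vector [y k] is null along [p] and so small that it does not disturb the
    times used before, but at some later time [N k] it is sent outside a large
    multiple of a neighbourhood of [0].  At that time each pair of points to be
    separated forbids only a short interval of coefficients, whatever the
    previous terms have become, so good coefficients exist
    ([avoid_on_line], [separate_clusters]).  The partial sums are null along [p],
    hence common times in [p] bring them all near [0].

    The construction does not separate the vectors [z j s] alone, but the finite
    clusters [A j + z j s] for finite sets [A j] fixed beforehand.  This is what
    makes it work in hyperspaces: two compact sets are Hausdorff far as soon as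
    all their points are mutually far.  Finite sets of null vectors are dense
    among the compact sets, and fuzzy sets supported by finitely many null
    vectors are dense for the supremum metric ([finite_fuzzy_approx]), hence for
    the Skorokhod metric.  So a translate of such an object by [z j s] stays in
    any prescribed open set, and when [s] runs over the digits of the points of
    the ternary set these translates form a Cantor set
    ([CD_LYC_of_translates]).  In the fuzzy case separation is read off the level
    [1], which reparametrizations of the levels leave in place.

    For the sendograph and endograph metrics only uniform chaos is claimed, and
    the singletons suffice: on them these metrics are at least [min d 1]
    ([U_LYC_of_embedding]). *)

Set Implicit Arguments.
Unset Strict Implicit.
Unset Printing Implicit Defensive.

Import Order.TTheory GRing.Theory Num.Theory.
Import numFieldNormedType.Exports.

Local Open Scope classical_set_scope.
Local Open Scope ring_scope.

(** * Translation-invariant metrics and iterates of an operator *)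

Section FrechetMetric.
Context (R : realType) (K : numFieldType) (X : tvsType K) (d : X -> X -> R).
Context (hd : frechet_metric d).
Implicit Types (x y z : X) (e : R).

Lemma metric_refl x : d x x = 0.
Proof. exact/(fmetric_eq0 hd). Qed.

Lemma metric_sub x y : d x y = d (x - y) 0.
Proof. by rewrite -(fmetric_translation hd (x - y) 0 y) subrK add0r. Qed.

Lemma metric_addr x y z : d (z + x) (z + y) = d x y.
Proof. by rewrite ![z + _]addrC (fmetric_translation hd). Qed.

Lemma metric0_opp x : d (- x) 0 = d x 0.
Proof. by rewrite (fmetric_sym hd x 0) (metric_sub 0 x) sub0r. Qed.

Lemma metric0_add x y : d (x + y) 0 <= d x 0 + d y 0.
Proof.
by apply: le_trans (fmetric_triangle hd _ y _) _; rewrite metric_sub addrK.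
Qed.

Lemma metric0_sub x y : d (x - y) 0 <= d x 0 + d y 0.
Proof. by rewrite -(metric0_opp y); exact: metric0_add. Qed.

Lemma metric_ball_nbhs x e : 0 < e -> nbhs x [set y | d x y < e].
Proof. by move=> e0; apply/(fmetric_nbhs hd); exists e. Qed.

Lemma metric_ball0_nbhs e : 0 < e -> nbhs (0 : X) [set y | d y 0 < e].
Proof.
move=> e0; apply/(fmetric_nbhs hd); exists e => // y /=.
by rewrite (fmetric_sym hd).
Qed.

Lemma cvg_metric (u : nat -> X) (l : X) :
  u @ \oo --> l <->
  forall e, 0 < e -> exists N : nat, forall n, (N <= n)%N -> d (u n) l < e.
Proof.
split=> [ul e e0|h A /(fmetric_nbhs hd)[e e0 eA]].
  have [N _ hN] := ul _ (metric_ball_nbhs l e0).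
  by exists N => n Nn; rewrite (fmetric_sym hd); exact: hN.
have [N hN] := h _ e0; exists N => // n /= Nn; apply: eA => /=.
by rewrite (fmetric_sym hd); exact: hN.
Qed.

Lemma continuous_metric (f : X -> X) : continuous f -> forall x e, 0 < e ->
  exists2 delta : R, 0 < delta & forall y, d x y < delta -> d (f x) (f y) < e.
Proof.
move=> cf x e e0; have := cf x _ (metric_ball_nbhs (f x) e0).
by move=> /(fmetric_nbhs hd)[r r0 hr]; exists r.
Qed.

Lemma scale_metric (c : K) e : 0 < e ->
  exists2 delta : R, 0 < delta & forall x, d x 0 < delta -> d (c *: x) 0 < e.
Proof.
move=> e0; have cf : continuous (fun x : X => c *: x).
  move=> x; apply: (@cvg_comp _ _ _ (fun y : X => (c : K^o, y))
    (fun z : K^o * X => z.1 *: z.2) _ (nbhs (c : K^o, x))).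
    by apply: (@cvg_pair _ _ _ _ (nbhs (c : K^o))); [exact: cvg_cst|exact: cvg_id].
  exact: (@scale_continuous K X (c, x)).
have [r r0 hr] := continuous_metric cf 0 e0; exists r => // x xr.
have := hr x; rewrite scaler0 (fmetric_sym hd 0) (fmetric_sym hd 0); exact.
Qed.

(** Joint continuity of the scalar multiplication at the origin gives this for
    small scalars; a fixed rescaling then reaches the whole unit disc. *)
Lemma balanced_metric e : 0 < e -> exists2 delta : R, 0 < delta &
  forall (c : K) x, `|c| <= 1 -> d x 0 < delta -> d (c *: x) 0 < e.
Proof.
move=> e0; have := @scale_continuous K X (0, 0).
rewrite /continuous_at /= scale0r => /(_ _ (metric_ball0_nbhs e0)).
case=> -[B1 B2] /= [/nbhs_ballP[r /= r0 rB1]] /(fmetric_nbhs hd)[t t0 tB2] B.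
pose c0 : K := r / 2.
have c00 : 0 < c0 by rewrite divr_gt0.
have [delta delta0 hdelta] := scale_metric c0^-1 t0.
exists delta => // c x c1 xd; have -> : c *: x = (c * c0) *: (c0^-1 *: x).
  by rewrite scalerA mulfK// gt_eqF.
apply: (B (c * c0, c0^-1 *: x)); split => /=.
  apply: rB1; rewrite -ball_normE /ball_ /= sub0r normrN normrM (gtr0_norm c00).
  apply: (@le_lt_trans _ _ c0); last by rewrite /c0 ltr_pdivrMr// ltr_pMr ?ltr1n.
  by rewrite ler_piMl// ltW.
by apply: tB2; rewrite /= (fmetric_sym hd); exact: hdelta.
Qed.

Context (T : {linear X -> X}).

Lemma iter_linearD n x y : iter n T (x + y) = iter n T x + iter n T y.
Proof. by elim: n => //= n ->; rewrite linearD. Qed.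

Lemma iter_linearZ n (c : K) x : iter n T (c *: x) = c *: iter n T x.
Proof. by elim: n => //= n ->; rewrite linearZ. Qed.

Lemma iter_linear0 n : iter n T 0 = 0.
Proof. by elim: n => //= n ->; rewrite linear0. Qed.

Lemma iter_linearN n x : iter n T (- x) = - iter n T x.
Proof. by elim: n => //= n ->; rewrite linearN. Qed.

Lemma iter_linearB n x y : iter n T (x - y) = iter n T x - iter n T y.
Proof. by rewrite iter_linearD iter_linearN. Qed.

Context (hT : continuous T).

Lemma iter_continuous n : continuous (iter n T).
Proof.
elim: n => [|n IH] x /=; first exact: cvg_id.
by apply: continuous_comp; [exact: IH|exact: hT].
Qed.

Lemma iter_metric (M : nat) e : 0 < e -> exists2 delta : R, 0 < delta &
  forall i x, (i <= M)%N -> d x 0 < delta -> d (iter i T x) 0 < e.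
Proof.
move=> e0; elim: M => [|M [r r0 hr]].
  by exists e => // i x; rewrite leqn0 => /eqP->.
have [t t0 ht] := continuous_metric (@iter_continuous M.+1) 0 e0.
exists (Num.min r t); first by rewrite lt_min r0.
move=> i x; rewrite lt_min leq_eqVlt => /orP[/eqP->|iM] /andP[xr xt].
  by have := ht x; rewrite iter_linear0 (fmetric_sym hd 0) (fmetric_sym hd 0); exact.
exact: hr.
Qed.

Lemma iter_metric2 n e : 0 < e -> exists2 delta : R, 0 < delta &
  forall x y, d x y < delta -> d (iter n T x) (iter n T y) < e.
Proof.
move=> e0; have [r r0 hr] := iter_metric n e0; exists r => // x y xy.
by rewrite metric_sub -iter_linearB; apply: hr => //; rewrite -metric_sub.
Qed.

End FrechetMetric.

(** * Choosing coefficients that separate finitely many points *)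

Section Separation.
Context (R : realType) (K : numFieldType) (X : tvsType K) (d : X -> X -> R).
Context (hd : frechet_metric d).
Implicit Types (x y z v w : X) (e eta : R).

(** The largest balanced subset of the open ball of radius [e]; multiples by
    scalars of modulus at most [1] are what metric balls do not control. *)
Definition balanced_ball e : set X :=
  [set x | forall c : K, `|c| <= 1 -> d (c *: x) 0 < e].

Lemma balanced_ball_scale e (c : K) x :
  `|c| <= 1 -> balanced_ball e x -> balanced_ball e (c *: x).
Proof.
move=> c1 bx c' c'1; rewrite scalerA; apply: bx.
by rewrite normrM mulr_ile1.
Qed.

Lemma balanced_ball_pow3 e (l L : nat) v : (l <= L)%N ->
  balanced_ball e ((3 ^+ l)^-1 *: v) -> balanced_ball e ((3 ^+ L)^-1 *: v).
Proof.
move=> lL bl; have -> : (3 ^+ L)^-1 *: v = (3 ^+ (L - l))^-1 *: ((3 ^+ l)^-1 *: v).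
  by rewrite scalerA -invfM -exprD subnK.
apply: balanced_ball_scale => //.
by rewrite ger0_norm ?invr_ge0 ?exprn_ge0// invf_le1 ?exprn_gt0// exprn_ege1 ?ler1n.
Qed.

(** Two parameters for which [w + c *: v] is near [0] are close to each other:
    otherwise a fair multiple of [v] would be small.  So one of the outer thirds
    of the interval is free of bad parameters for the first vector of the list,
    and the others are treated inside that third.  The number of subdivisions
    explains the power of [3]. *)
Lemma avoid_on_line e eta : (forall x, d x 0 < eta + eta -> balanced_ball e x) ->
  forall (ws : seq X) (a h : K) v, 0 <= h ->
  ~ balanced_ball e (((3 ^+ size ws)^-1 * h) *: v) ->
  exists c : K, [/\ a <= c, c <= a + h &
    forall w, w \in ws -> eta <= d (w + c *: v) 0].
Proof.
move=> hb; elim=> [|w ws IH] a h v h0 hv.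
  by exists a; split=> //; rewrite lerDl.
have h30 : 0 <= h / 3 by rewrite divr_ge0.
have hv3 : ~ balanced_ball e (((3 ^+ size ws)^-1 * (h / 3)) *: v).
  by move: hv; rewrite /= exprS invfM; rewrite mulrAC mulrC mulrA mulrAC -mulrA.
have hh : h = h / 3 + h / 3 + h / 3.
  by rewrite -!mulrDl -[h in h + h + h]mulr1 -!mulrDr -natr1 -natr1 mulfK.
have [[c1 [ac1 c1a wc1]]|hno] :=
    pselect (exists c, [/\ a <= c, c <= a + h / 3 & d (w + c *: v) 0 < eta]).
  have [c [ac cah hc]] := IH (a + h / 3 + h / 3) (h / 3) v h30 hv3.
  exists c; split.
  - by apply: le_trans ac; rewrite -addrA lerDl addr_ge0.
  - by rewrite hh !addrA.
  move=> w'; rewrite inE => /orP[/eqP->|]; last exact: hc.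
  rewrite leNgt; apply/negP => wc; apply: hv3.
  have hc1 : h / 3 <= c - c1.
    rewrite lerBrDr addrC; apply: le_trans ac.
    by rewrite lerD2r.
  have cc0 : 0 <= c - c1 by exact: le_trans hc1.
  have bal : balanced_ball e ((c - c1) *: v).
    apply: hb; rewrite scalerBl.
    have -> : c *: v - c1 *: v = (w + c *: v) - (w + c1 *: v).
      by rewrite opprD addrACA subrr add0r.
    by apply: le_lt_trans (metric0_sub hd _ _) _; exact: ltrD.
  have [c0|c0] := eqVneq (c - c1) 0.
    have -> : h / 3 = 0 by apply/eqP; rewrite eq_le h30 andbT -c0.
    by rewrite mulr0 -c0.
  have -> : ((3 ^+ size ws)^-1 * (h / 3)) *: v =
            ((3 ^+ size ws)^-1 * (h / 3) / (c - c1)) *: ((c - c1) *: v).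
    by rewrite scalerA mulfVK.
  apply: balanced_ball_scale => //.
  have cp : 0 < c - c1 by rewrite lt_def c0.
  rewrite ger0_norm; last by rewrite !mulr_ge0// ?invr_ge0// exprn_ge0.
  rewrite ler_pdivrMr// mul1r; apply: le_trans hc1; apply: ler_piMl => //.
  by rewrite invf_le1 ?exprn_gt0// exprn_ege1 ?ler1n.
have [c [ac cah hc]] := IH a (h / 3) v h30 hv3.
exists c; split=> //.
  by apply: le_trans cah _; rewrite lerD2l {2}hh -addrA lerDl addr_ge0.
move=> w'; rewrite inE => /orP[/eqP->|]; last exact: hc.
rewrite real_leNgt ?num_real//; apply/negP => wc; apply: hno.
by exists c.
Qed.

(** The coefficients are chosen one after the other; each new one has to avoid
    finitely many short intervals.  The threshold [L] depends only on the sizes of the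
    clusters: in the application [v] is chosen before the clusters, which are
    images by an iterate of [T] that depends on [v], are known. *)
Lemma separate_clusters e eta :
  (forall x, d x 0 < eta + eta -> balanced_ball e x) ->
  forall (J : eqType) (m : J -> nat) (I : seq J), exists L : nat, forall v,
  ~ balanced_ball e ((3 ^+ L)^-1 *: v) ->
  forall B : J -> seq X, (forall a, size (B a) = m a) ->
  exists c : J -> K, (forall a, 0 <= c a <= 1) /\
    forall a b, a \in I -> b \in I -> a != b ->
    forall x y, x \in B a -> y \in B b ->
      eta <= d (x + c a *: v) (y + c b *: v).
Proof.
move=> hb J m; elim=> [|a0 I [L hL]].
  by exists 0%N => v _ B _; exists (fun=> 0); split=> // a; rewrite lexx ler01.
have [a0I|a0I] := boolP (a0 \in I).
  exists L => v hv B hB; have [c [c01 hc]] := hL v hv B hB.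
  exists c; split=> // a b; rewrite !inE => aI bI; apply: hc.
    by move: aI => /predU1P[->|].
  by move: bI => /predU1P[->|].
pose q := (m a0 * sumn [seq m b | b <- I])%N.
exists (L + q)%N => v hv B hB.
have [|c [c01 hc]] := hL v _ B hB.
  by apply: contra_not hv; apply: balanced_ball_pow3; rewrite leq_addr.
pose ys := flatten [seq [seq y + c b *: v | y <- B b] | b <- I].
pose ws := [seq x - y | x <- B a0, y <- ys].
have sws : size ws = q.
  rewrite /ws size_allpairs hB /q size_flatten /shape -map_comp; congr (_ * sumn _)%N.
  by apply: eq_map => b /=; rewrite size_map hB.
have [|t [t0 t1 ht]] := @avoid_on_line _ _ hb ws 0 1 v ler01.
  rewrite mulr1 sws; apply: contra_not hv.
  by apply: balanced_ball_pow3; rewrite leq_addl.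
rewrite add0r in t1.
have key b x y : b \in I -> x \in B a0 -> y \in B b ->
    eta <= d (x + t *: v) (y + c b *: v).
  move=> bI xB yB; rewrite (metric_sub hd) addrAC; apply: ht.
  apply: allpairs_f => //; apply/flatten_mapP; exists b => //.
  exact: map_f.
exists (fun a => if a == a0 then t else c a); split=> [a|a b].
  by case: ifP => // _; rewrite t0.
rewrite !inE; case: eqVneq => [->|aa0] /=; case: eqVneq => [->|ba0] //=.
- by move=> _ bI _ x y xB yB; exact: key.
- by move=> aI _ _ x y xB yB; rewrite (fmetric_sym hd); exact: key.
- by move=> aI bI ab x y; exact: hc.
Qed.

End Separation.

(** * Scrambled families of vectors *)

Lemma dependent_choice (A : Type) (P : A -> Prop) (Q : nat -> A -> A -> Prop)
    (a : A) : P a -> (forall k x, P x -> exists y, P y /\ Q k x y) ->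
  exists f : nat -> A, [/\ f 0%N = a, forall k, P (f k) &
    forall k, Q k (f k) (f k.+1)].
Proof.
move=> Pa h.
have /choice[F hF] : forall q : nat * A, exists y : A,
    P q.2 -> P y /\ Q q.1 q.2 y.
  move=> [k x]; have [Px|nPx] := pselect (P x); last by exists a.
  by have [y hy] := h k x Px; exists y.
pose f := fix f k := if k is k'.+1 then F (k', f k') else a.
have Pf k : P (f k) by elim: k => //= k IH; have [] := hF (k, f k) IH.
by exists f; split=> // k; have [] := hF (k, f k) (Pf k).
Qed.

Section ScrambledFamily.
Context (R : realType) (K : numFieldType) (X : tvsType K) (d : X -> X -> R).
Context (hd : frechet_metric d) (T : {linear X -> X}) (hT : continuous T).
Implicit Types (x y z : X) (e delta : R) (p : nat -> nat).

Definition null_along p : set X :=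
  [set x : X | (fun k => iter (p k) T x) @ \oo --> (0 : X)].

(** Failure of equicontinuity at the origin, witnessed inside [E]. *)
Definition expanding_on (E : set X) : Prop :=
  exists2 e : R, 0 < e & forall delta : R, 0 < delta ->
    exists y, [/\ E y, d y 0 < delta & exists n, e <= d (iter n T y) 0].

Lemma null_alongP p x : null_along p x <->
  forall e, 0 < e -> exists N : nat, forall n, (N <= n)%N ->
    d (iter (p n) T x) 0 < e.
Proof. exact: (cvg_metric hd). Qed.

Lemma null_along0 p : null_along p 0.
Proof.
by apply/null_alongP => e e0; exists 0%N => n _; rewrite iter_linear0 metric_refl.
Qed.

Lemma null_alongD p x y :
  null_along p x -> null_along p y -> null_along p (x + y).
Proof.
move=> /null_alongP hx /null_alongP hy; apply/null_alongP => e e0.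
have e20 : 0 < e / 2 by rewrite divr_gt0.
have [N hN] := hx _ e20; have [M hM] := hy _ e20.
exists (maxn N M) => n; rewrite geq_max => /andP[/hN hxn /hM hyn].
rewrite iter_linearD; apply: le_lt_trans (metric0_add hd _ _) _.
by rewrite [e]splitr ltrD.
Qed.

Lemma null_alongZ p (c : K) x : null_along p x -> null_along p (c *: x).
Proof.
move=> /null_alongP hx; apply/null_alongP => e e0.
have [delta delta0 hdelta] := scale_metric hd c e0.
have [N hN] := hx _ delta0; exists N => n /hN hn.
by rewrite iter_linearZ; exact: hdelta.
Qed.

Lemma null_along_seq p (xs : seq X) : (forall x, x \in xs -> null_along p x) ->
  forall e, 0 < e -> exists N : nat, forall n, (N <= n)%N ->
    forall x, x \in xs -> d (iter (p n) T x) 0 < e.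
Proof.
elim: xs => [|x xs IH] hx e e0; first by exists 0%N.
have /null_alongP/(_ _ e0)[N hN] := hx x (mem_head _ _).
have [|M hM] := IH _ e e0; first by move=> y yxs; apply: hx; rewrite inE yxs orbT.
exists (maxn N M) => n; rewrite geq_max => /andP[/hN h1 /hM h2] y.
by rewrite inE => /predU1P[->|] //; exact: h2.
Qed.

(** A small vector sent outside the ball is multiplied by a power of [3] fixed in
    advance: it remains small, and its image leaves a large multiple of the
    balanced ball.  The time [N] is large because the first [k] iterates are
    equicontinuous. *)
Lemma expanding_vector e p :
  (forall delta, 0 < delta -> exists y,
    [/\ null_along p y, d y 0 < delta & exists n, e <= d (iter n T y) 0]) ->
  0 < e -> forall delta (M L k : nat), 0 < delta ->
  exists y N, [/\ null_along p y,
    forall (c : K) i, `|c| <= 1 -> (i <= M)%N -> d (iter i T (c *: y)) 0 < delta,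
    (k < N)%N & ~ balanced_ball d e ((3 ^+ L)^-1 *: iter N T y)].
Proof.
move=> he e0 delta M L k delta0.
have [d1 d10 h1] := iter_metric hd hT M delta0.
have [d2 d20 h2] := balanced_metric hd d10.
have [d3 d30 h3] := scale_metric hd (3 ^+ L) d20.
have [d4 d40 h4] := iter_metric hd hT k e0.
have m0 : 0 < Num.min d3 d4 by rewrite lt_min d30.
have [y [ny]] := he _ m0; rewrite lt_min => /andP[yd3 yd4] [N hN].
exists (3 ^+ L *: y), N; split.
- exact: null_alongZ.
- by move=> c i c1 iM; apply: h1 => //; apply: h2 => //; exact: h3.
- by rewrite ltnNge; apply/negP => Nk; move: hN; rewrite leNgt h4.
rewrite iter_linearZ scalerA mulVf ?expf_neq0// scale1r.
by move=> /(_ 1); rewrite normr1 scale1r => /(_ (lexx _)); rewrite ltNge hN.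
Qed.

Definition bits (k : nat) : seq bitseq := [seq val t | t <- enum {: k.-tuple bool}].

Lemma mem_bits k (s : bitseq) : (s \in bits k) = (size s == k).
Proof.
apply/mapP/idP => [[t _ ->]|sk]; first by rewrite size_tuple.
by exists (Tuple sk) => //; rewrite mem_enum.
Qed.

Context (p : nat -> nat) (e eps : R) (e0 : 0 < e) (eps0 : 0 < eps).
Context (hbal : forall x, d x 0 < 3 * eps + 3 * eps -> balanced_ball d e x).
Context (hexp : forall delta, 0 < delta -> exists y,
    [/\ null_along p y, d y 0 < delta & exists n, e <= d (iter n T y) 0]).
Context (A : nat -> seq X).

(** One stage.  The partial sums [S j s] are indexed by prefixes [s] of binary
    sequences, so that only finitely many clusters are active.  The bound [M]
    collects the times already used, which the new term must not disturb.  The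
    families with index above [k] do not change at this stage. *)
Lemma scramble_step (k : nat) (S : nat -> bitseq -> X) (M : nat) delta :
  0 < delta -> (forall j s, null_along p (S j s)) ->
  exists S' N n M',
  [/\ forall j s, null_along p (S' j s),
      forall j s i, (i <= M)%N ->
        d (iter i T (S' j s - S j (take k s))) 0 < delta,
      forall j s, (k < j)%N -> S' j s = S j (take k s),
      [/\ (k < N)%N, (k <= n)%N, (M <= M')%N, (N <= M')%N & (p n <= M')%N] &
      (forall j l s t, (j <= k)%N -> (l <= k)%N -> size s = k.+1 ->
        size t = k.+1 -> (j, s) != (l, t) ->
        forall x y, x \in A j -> y \in A l ->
        3 * eps <= d (iter N T (x + S' j s)) (iter N T (y + S' l t))) /\
      (forall j s, (j <= k)%N -> size s = k.+1 ->
        d (iter (p n) T (S' j s)) 0 < delta)].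
Proof.
move=> delta0 hS.
pose I : seq (nat * bitseq) := [seq (j, s) | j <- iota 0 k.+1, s <- bits k.+1].
have memI j s : (j <= k)%N -> size s = k.+1 -> (j, s) \in I.
  move=> jk sk; apply: allpairs_f; first by rewrite mem_iota.
  by rewrite mem_bits sk.
have [L hL] := separate_clusters hd hbal (fun a => size (A a.1)) I.
have [y [N [ny hy kN hyN]]] := expanding_vector hexp e0 M L k delta0.
pose B (a : nat * bitseq) :=
  [seq iter N T (x + S a.1 (take k a.2)) | x <- A a.1].
have [|c [c01 hc]] := hL _ hyN B; first by move=> a; rewrite size_map.
pose S' j s := S j (take k s) + (if (j <= k)%N then c (j, s) else 0) *: y.
have c1 j s : `|if (j <= k)%N then c (j, s) else 0| <= 1.
  case: ifP => _; last by rewrite normr0 ler01.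
  by have /andP[c0 c1] := c01 (j, s); rewrite ger0_norm.
have nS' j s : null_along p (S' j s).
  by apply: null_alongD => //; exact: null_alongZ.
have [n0 hn0] := @null_along_seq p [seq S' a.1 a.2 | a <- I]
  (ltac:(by move=> x /mapP[a _ ->])) _ delta0.
pose n := maxn n0 k.
exists S', N, n, (maxn M (maxn N (p n))); split=> //.
- by move=> j s i iM; rewrite /S' addrC addKr; exact: hy.
- by move=> j s kj; rewrite /S' leqNgt kj /= scale0r addr0.
- split=> //; rewrite ?leq_max ?leqnn ?orbT//.
split=> [j l s t jk lk sk tk neq x x' xA xA'|j s jk sk].
  rewrite /S' jk lk !addrA !(iter_linearD _ N _ (_ *: _)) !iter_linearZ.
  apply: (hc (j, s) (l, t)) => //; try exact: memI.
    by apply/mapP; exists x.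
  by apply/mapP; exists x'.
apply: hn0; first by rewrite leq_max leqnn.
by apply/mapP; exists (j, s) => //; exact: memI.
Qed.

(** The points of [A j] are base points, of which the [z j s] are perturbations.
    One time [N] separates all the prefixes of length [k.+1] at once: this gives
    the upper limits, and also the continuity of the inverse of the coding. *)
Record scrambled_family (r : nat -> R) (z : nat -> (nat -> bool) -> X) : Prop :=
  ScrambledFamily {
  sf_small : forall j s, d (z j s) 0 < r j ;
  sf_cont : forall (delta : R), 0 < delta -> exists k, forall j s t,
    mkseq s k = mkseq t k -> d (z j s) (z j t) < delta ;
  sf_apart : forall k, exists2 N, (k < N)%N & forall j l s t,
    (j <= k)%N -> (l <= k)%N -> (j, mkseq s k.+1) != (l, mkseq t k.+1) ->
    forall x y, x \in A j -> y \in A l ->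
    eps <= d (iter N T (x + z j s)) (iter N T (y + z l t)) ;
  sf_null : forall k (delta : R), 0 < delta -> exists2 n, (k <= n)%N &
    forall j s, (j <= k)%N -> d (iter (p n) T (z j s)) 0 < delta }.

(** The increments at stage [k] are at most half of [D k], so the tail from stage
    [k] on moves the iterates at the times bounded by [M k] by at most [D k].  The
    margin [3 * eps] of the stages thus leaves [eps] in the limit. *)
Lemma scrambled_family_exists (r : nat -> R) : (forall j, 0 < r j) ->
  exists z : nat -> (nat -> bool) -> X, scrambled_family r z.
Proof.
move=> r0.
(* [D] halves at each stage and is capped by [r k], since family [k] starts there. *)
pose D := fix D k := if k is k'.+1 then Num.min (D k' / 2) (r k / 2)
                     else Num.min (eps / 2) (r 0%N / 2).
have D0 k : 0 < D k.
  by elim: k => [|k IH] /=; rewrite lt_min !divr_gt0.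
have DS k : D k.+1 <= D k / 2 by rewrite /= ge_min lexx.
have Dr k : D k < r k.
  apply: (@le_lt_trans _ _ (r k / 2)); last first.
    by rewrite ltr_pdivrMr// ltr_pMr// ltr1n.
  by case: k => [|k] /=; rewrite ge_min lexx orbT.
have Deps k : D k <= eps / 2.
  elim: k => [|k IH]; first by rewrite /= ge_min lexx.
  by apply: le_trans (DS k) _; have := D0 k; have := eps0; lra.
have Dle k l : (k <= l)%N -> D l <= D k.
  elim: l => [|l IH]; first by rewrite leqn0 => /eqP->.
  rewrite leq_eqVlt => /predU1P[->//|]; rewrite ltnS => /IH kl.
  by apply: le_trans (DS l) _; apply: le_trans kl; have := D0 l; lra.
have Dlim delta : 0 < delta -> exists k, D k < delta.
  move=> delta0.
  have Dk k : D k * 2 ^+ k <= eps.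
    elim: k => [|k IH].
      by rewrite expr0 mulr1; apply: le_trans (Deps 0%N) _; rewrite ler_pdivrMr// ler_pMr// ler1n.
    apply: le_trans IH; rewrite exprS mulrA ler_pM2r ?exprn_gt0//.
    by rewrite -ler_pdivlMr.
  pose k := Num.bound (eps / delta).
  exists k; rewrite -(@ltr_pM2r _ (2 ^+ k)) ?exprn_gt0//.
  apply: le_lt_trans (Dk k) _; rewrite mulrC -ltr_pdivrMr//.
  apply: lt_trans (archi_boundP _) _; first by rewrite divr_ge0 ?ltW.
  by rewrite -natrX ltr_nat ltn_expl.
pose St := ((nat -> bitseq -> X) * nat * nat * nat)%type.
pose P (q : St) := forall j s, null_along p (q.1.1.1 j s).
pose Q k (q q' : St) := let: (S0, _, _, M) := q in let: (S', N, n, M') := q' in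
  [/\ forall j s i, (i <= M)%N ->
        d (iter i T (S' j s - S0 j (take k s))) 0 < D k / 2,
      forall j s, (k < j)%N -> S' j s = S0 j (take k s),
      [/\ (k < N)%N, (k <= n)%N, (M <= M')%N, (N <= M')%N & (p n <= M')%N],
      (forall j l s t, (j <= k)%N -> (l <= k)%N -> size s = k.+1 ->
        size t = k.+1 -> (j, s) != (l, t) ->
        forall x y, x \in A j -> y \in A l ->
        3 * eps <= d (iter N T (x + S' j s)) (iter N T (y + S' l t))) &
      (forall j s, (j <= k)%N -> size s = k.+1 ->
        d (iter (p n) T (S' j s)) 0 < D k / 2)].
pose q0 : St := (fun _ _ => 0, 0%N, 0%N, 0%N).
have Pq0 : P q0 by move=> j s; exact: null_along0.
have [|f [f0 Pf Qf]] := @dependent_choice St P Q q0 Pq0.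
  move=> k [[[S N] n] M] PS; have D20 : 0 < D k / 2 by rewrite divr_gt0.
  have [S' [N' [n' [M' [h1 h2 h3 h4 [h5 h6]]]]]] := scramble_step k M D20 PS.
  by exists (S', N', n', M'); split.
pose S k := (f k).1.1.1; pose N k := (f k).1.1.2.
pose n k := (f k).1.2; pose M k := (f k).2.
have QS k : [/\ forall j s i, (i <= M k)%N ->
        d (iter i T (S k.+1 j s - S k j (take k s))) 0 < D k / 2,
      forall j s, (k < j)%N -> S k.+1 j s = S k j (take k s),
      [/\ (k < N k.+1)%N, (k <= n k.+1)%N, (M k <= M k.+1)%N,
          (N k.+1 <= M k.+1)%N & (p (n k.+1) <= M k.+1)%N],
      (forall j l s t, (j <= k)%N -> (l <= k)%N -> size s = k.+1 ->
        size t = k.+1 -> (j, s) != (l, t) ->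
        forall x y, x \in A j -> y \in A l ->
        3 * eps <= d (iter (N k.+1) T (x + S k.+1 j s))
                     (iter (N k.+1) T (y + S k.+1 l t))) &
      (forall j s, (j <= k)%N -> size s = k.+1 ->
        d (iter (p (n k.+1)) T (S k.+1 j s)) 0 < D k / 2)].
  have := Qf k; rewrite /S /N /n /M.
  by case: (f k) => -[[S0 N0] n0] M0; case: (f k.+1) => -[[S1 N1] n1] M1.
pose w j s k := S k j (mkseq s k).
have take_mkseq s k : take k (mkseq s k.+1) = mkseq s k.
  by rewrite /mkseq -map_take take_iota (minn_idPl (leqnSn k)).
have wS j s k i : (i <= M k)%N -> d (iter i T (w j s k.+1 - w j s k)) 0 < D k / 2.
  by move=> iM; have [h _ _ _ _] := QS k; have := h j (mkseq s k.+1) i iM; rewrite take_mkseq.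
have Mle k l : (k <= l)%N -> (M k <= M l)%N.
  elim: l => [|l IH]; first by rewrite leqn0 => /eqP->.
  rewrite leq_eqVlt => /predU1P[->//|]; rewrite ltnS => /IH kl.
  by apply: leq_trans kl _; have [_ _ [_ _ ? _ _] _ _] := QS l.
(* An increment below [D k / 2] is at most [D k - D k.+1], so the sum telescopes. *)
have wtail j s k i l : (i <= M k)%N ->
    d (iter i T (w j s (k + l)%N - w j s k)) 0 <= D k - D (k + l)%N.
  move=> iM; elim: l => [|l IH].
    by rewrite addn0 !subrr iter_linear0 (metric_refl hd).
  rewrite addnS.
  have -> : w j s (k + l).+1 - w j s k =
      (w j s (k + l).+1 - w j s (k + l)%N) + (w j s (k + l)%N - w j s k).
    by rewrite addrA subrK.
  rewrite iter_linearD; apply: le_trans (metric0_add hd _ _) _.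
  have := wS j s (k + l)%N i (leq_trans iM (Mle _ _ (leq_addr _ _))).
  have := DS (k + l)%N; move: IH.
  move: (d _ _) (d _ _) => a b; move: (D k) (D _) (D _.+1) => x y z'; lra.
have wcauchy j s : exists l : X, w j s @ \oo --> l.
  apply: (fmetric_complete hd) => delta delta0.
  have d20 : 0 < delta / 2 by rewrite divr_gt0.
  have [k hk] := Dlim _ d20; exists k => a b ka kb.
  have h c : (k <= c)%N -> d (w j s c) (w j s k) <= D k.
    move=> kc; rewrite (metric_sub hd).
    have := wtail j s k 0%N (c - k)%N (leq0n _); rewrite subnKC//= => h.
    by apply: le_trans h _; rewrite gerBl ltW.
  apply: le_lt_trans (fmetric_triangle hd _ (w j s k) _) _.
  rewrite [ltRHS]splitr ltrD//; first by apply: le_lt_trans (h a ka) _.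
  by rewrite (fmetric_sym hd); apply: le_lt_trans (h b kb) _.
have /choice[z hz] : forall js : nat * (nat -> bool),
    exists l : X, w js.1 js.2 @ \oo --> l by move=> [j s]; exact: wcauchy.
have zw j s k i : (i <= M k)%N -> d (iter i T (z (j, s))) (iter i T (w j s k)) <= D k.
  move=> iM; apply/ler_addgt0Pr => delta delta0.
  have [t t0 ht] := iter_metric2 hd hT i delta0.
  have /(cvg_metric hd)/(_ _ t0)[n1 hn1] := hz (j, s).
  apply: le_trans (fmetric_triangle hd _ (iter i T (w j s (k + n1)%N)) _) _.
  rewrite addrC lerD//.
    rewrite (metric_sub hd) -iter_linearB.
    by apply: le_trans (wtail j s k i n1 iM) _; rewrite gerBl ltW.
  by apply/ltW/ht; rewrite (fmetric_sym hd); exact: hn1 (leq_addl _ _).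
exists (fun j s => z (j, s)); split.
- move=> j s; have S0 k : (k <= j)%N -> forall u, S k j u = 0.
    elim: k => [_ u|k IH kj u]; first by rewrite /S f0.
    by have [_ h _ _ _] := QS k; rewrite h// IH// ltnW.
  have := zw j s j 0%N (leq0n _); rewrite /= /w S0// => h.
  exact: le_lt_trans h (Dr j).
- move=> delta delta0; have d20 : 0 < delta / 2 by rewrite divr_gt0.
  have [k hk] := Dlim _ d20; exists k => j s t st.
  have h1 := zw j s k 0%N (leq0n _); have h2 := zw j t k 0%N (leq0n _).
  apply: le_lt_trans (fmetric_triangle hd _ (w j s k) _) _.
  rewrite [ltRHS]splitr ltrD//; first by apply: le_lt_trans h1 _.
  by rewrite /w st (fmetric_sym hd); apply: le_lt_trans h2 _.
- move=> k; have [_ _ [kN _ _ NM _] hsep _] := QS k.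
  exists (N k.+1) => // j l s t jk lk neq x y xA yA.
  have := hsep j l (mkseq s k.+1) (mkseq t k.+1) jk lk
    (size_mkseq _ _) (size_mkseq _ _) neq x y xA yA.
  have := zw l t k.+1 _ NM; have := zw j s k.+1 _ NM; have := Deps k.+1.
  rewrite /w !iter_linearD.
  set a := iter _ _ (z (j, s)); set b := iter _ _ (z (l, t)).
  set a' := iter _ _ (S _ j _); set b' := iter _ _ (S _ l _).
  set x' := iter _ _ x; set y' := iter _ _ y.
  have := fmetric_triangle hd (x' + a') (x' + a) (y' + b').
  have := fmetric_triangle hd (x' + a) (y' + b) (y' + b').
  rewrite !(metric_addr hd) (fmetric_sym hd a' a).
  move: (d _ _) (d _ _) (d _ _) (d _ _) (d _ _) => ? ? ? ? ?.
  by move: (D _) eps0 => ?; lra.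
move=> k delta delta0; have [l hl] := Dlim _ (divr_gt0 delta0 (ltr0n _ 2)).
pose k' := maxn k l; have [_ _ [_ kn _ _ nM] _ hnull] := QS k'.
exists (n k'.+1); first by apply: leq_trans kn; rewrite leq_maxl.
move=> j s jk; apply: le_lt_trans (fmetric_triangle hd _
  (iter (p (n k'.+1)) T (w j s k'.+1)) _) _.
have h1 := zw j s k'.+1 _ nM.
have h2 := hnull j (mkseq s k'.+1) (leq_trans jk (leq_maxl _ _)) (size_mkseq _ _).
have h3 := Dle l k' (leq_maxr _ _); have h4 := DS k'.
rewrite -/(w j s k'.+1) in h2.
move: h1 h2 h3 h4 hl (D0 k').
by move: (d _ _) (d _ _) (D k') (D _.+1) => ? ? ? ?; lra.
Qed.

End ScrambledFamily.

Section ScrambledFamilies.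
Context (R : realType) (K : numFieldType) (X : tvsType K) (d : X -> X -> R).
Context (hd : frechet_metric d) (T : {linear X -> X}) (hT : continuous T).

Lemma expanding_scrambled (p : nat -> nat) :
  expanding_on d T (null_along T p) ->
  exists2 eps : R, 0 < eps & forall (A : nat -> seq X) (r : nat -> R),
    (forall j, 0 < r j) ->
    exists z : nat -> (nat -> bool) -> X, scrambled_family d T p eps A r z.
Proof.
move=> [e e0 hexp]; have [t t0 ht] := balanced_metric hd e0.
(* The difference of two vectors of the [3 * eps]-ball lies in the [t]-ball. *)
exists (t / 6) => [|A r r0]; first by rewrite divr_gt0.
apply: (scrambled_family_exists hd hT e0) => //; first by rewrite divr_gt0.
by move=> x hx c c1; apply: ht => //; move: hx; lra.
Qed.

End ScrambledFamilies.

(** * Li-Yorke pairs *)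

Section LiYorke.
Context (R : realType).
Implicit Types (u : nat -> R) (e : R).

Lemma limn_esup_ge_frequently u e :
  (forall N, exists2 n, (N <= n)%N & e <= u n) ->
  (e%:E <= limn_esup (fun n => (u n)%:E))%E.
Proof.
move=> h; rewrite limn_esup_lim; apply: lime_ge; first exact: is_cvg_esups.
apply: nearW => N; have [n Nn en] := h N.
apply: (@le_trans _ _ (u n)%:E); first by rewrite lee_fin.
by apply: ereal_sup_ubound; exists n.
Qed.

Lemma limn_einf_eq0 u : (forall n, 0 <= u n) ->
  (forall N e, 0 < e -> exists2 n, (N <= n)%N & u n < e) ->
  limn_einf (fun n => (u n)%:E) = 0%E.
Proof.
move=> u0 h; rewrite limn_einf_lim.
suff -> : einfs (fun n => (u n)%:E) = cst 0%E by exact: lim_cst.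
apply/funext => N; apply/eqP; rewrite eq_le; apply/andP; split; last first.
  by apply: le_ereal_inf_tmp => _ [n _ <-]; rewrite lee_fin.
apply/lee_addgt0Pr => e e0; have [n Nn une] := h N e e0.
rewrite add0e; apply: (@le_trans _ _ (u n)%:E); last by rewrite lee_fin ltW.
by apply: ereal_inf_lbound; exists n.
Qed.

Lemma limn_esup_frequently u e e' : e' < e ->
  (e%:E <= limn_esup (fun n => (u n)%:E))%E ->
  forall N, exists2 n, (N <= n)%N & e' < u n.
Proof.
move=> ee' hu N.
have : (e'%:E < esups (fun n => (u n)%:E) N)%E.
  apply: (@lt_le_trans _ _ e%:E); first by rewrite lte_fin.
  apply: le_trans hu _; apply: ereal_inf_lbound.
  by exists [set k | (N <= k)%N] => //; exists N.
by move=> /ereal_sup_gt[_ [n Nn <-]]; rewrite lte_fin; exists n.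
Qed.

Lemma limn_einf_lt u e : 0 < e -> limn_einf (fun n => (u n)%:E) = 0%E ->
  exists n, u n < e.
Proof.
move=> e0 hu; apply: contrapT => hn.
suff : (e%:E <= limn_einf (fun n => (u n)%:E))%E.
  by rewrite hu lee_fin leNgt e0.
rewrite limn_einf_lim; apply: lime_ge; first exact: is_cvg_einfs.
apply: nearW => N; apply: le_ereal_inf_tmp => _ [n _ <-].
by rewrite lee_fin leNgt; apply/negP => ue; apply: hn; exists n.
Qed.

Context (Y : Type) (rho : Y -> Y -> R) (g : Y -> Y).

(** Once two orbits of an equicontinuous system come close, they stay close. *)
Lemma equicontinuous_not_scrambled e (S : set Y) x y : 0 < e ->
  equicontinuous_system rho g -> S x -> S y -> x <> y ->
  ~ li_yorke_scrambled rho g e S.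
Proof.
move=> e0 heq Sx Sy xy /(_ _ _ Sx Sy xy)[hsup hinf].
have e20 : 0 < e / 2 by rewrite divr_gt0.
have [t t0 ht] := heq _ e20.
have [n0 hn0] := limn_einf_lt t0 hinf.
have e2e : e / 2 < e by rewrite ltr_pdivrMr// ltr_pMr// ltr1n.
have [n n0n] := limn_esup_frequently e2e hsup n0.+1.
rewrite ltNge => /negP; apply; apply: ltW.
have := ht _ _ hn0 (n - n0)%N; rewrite subn_gt0 => /(_ n0n).
by rewrite -!iterD subnK// ltnW.
Qed.

Lemma U_LYC_not_equicontinuous : U_LYC rho g -> ~ equicontinuous_system rho g.
Proof.
move=> [e [e0 [S [cS hS]]]] heq; apply: cS.
have [[x Sx]|S0] := pselect (S !=set0); last first.
  suff -> : S = set0 by exact: countable0.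
  by apply/seteqP; split=> // y Sy; apply: S0; exists y.
apply: (@sub_countable _ _ _ [set x]); last exact: countable1.
apply: subset_card_le => y Sy; apply: contrapT => yx.
exact: (equicontinuous_not_scrambled e0 heq Sy Sx yx hS).
Qed.

End LiYorke.

(** * The ternary Cantor set and its digits *)

Section Ternary.
Context (R : realType).
Implicit Types (t u : R).

(** The inverse of the two contractions that define the ternary set; iterating it
    reads off the digits, [true] standing for the digit [2]. *)
Definition ternary_shift t : R := if t <= 2^-1 then 3 * t else 3 * t - 2.

Definition ternary_digits t (n : nat) : bool := 2^-1 < iter n ternary_shift t.

Lemma ternary_step_itv n t : @ternary_step R n t -> 0 <= t <= 1.
Proof.
elim: n t => [|n IH] t /=; first by rewrite in_itv.
by move=> [[x /IH/andP[x0 x1] <-]|[x /IH/andP[x0 x1] <-]]; apply/andP; split; lra.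
Qed.

Lemma ternary_step0 n : @ternary_step R n 0.
Proof.
elim: n => [|n IH] /=; first by rewrite in_itv/= lexx ler01.
by left; exists 0 => //; rewrite mul0r.
Qed.

Lemma ternary_step1 n : @ternary_step R n 1.
Proof.
elim: n => [|n IH] /=; first by rewrite in_itv/= lexx ler01.
by right; exists 1 => //; lra.
Qed.

Lemma ternary_set_itv t : @ternary_set R t -> 0 <= t <= 1.
Proof. by move=> /(_ 0%N I) /ternary_step_itv. Qed.

Lemma ternary_set_gap t : @ternary_set R t -> t <= 3^-1 \/ 2 / 3 <= t.
Proof.
move=> /(_ 1%N I) /= [[x xI <-]|[x xI <-]]; move: xI; rewrite /= in_itv/= => /andP[? ?].
  by left; lra.
by right; lra.
Qed.

Lemma ternary_set_shift t : @ternary_set R t -> @ternary_set R (ternary_shift t).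
Proof.
move=> ht n _; have := ht n.+1 I; rewrite /ternary_shift /=.
move=> [[x xn <-]|[x xn <-]]; have /andP[x0 x1] := ternary_step_itv xn.
  rewrite ifT; last by lra.
  by rewrite mulrC mulfVK.
rewrite ifF; last by apply/negbTE; rewrite -ltNge; lra.
by have -> : 3 * ((x + 2) / 3) - 2 = x by lra.
Qed.

Lemma ternary_digitsS t n :
  mkseq (ternary_digits t) n.+1 =
  (2^-1 < t) :: mkseq (ternary_digits (ternary_shift t)) n.
Proof.
rewrite /mkseq /= (iotaDl 1 0 n) -map_comp; congr cons.
by apply: eq_map => k /=; rewrite /ternary_digits add1n iterSr.
Qed.

Lemma ternary_digits_close n t u : @ternary_set R t -> @ternary_set R u ->
  mkseq (ternary_digits t) n = mkseq (ternary_digits u) n ->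
  `|t - u| <= (3 ^+ n)^-1.
Proof.
elim: n t u => [|n IH] t u ht hu.
  move=> _; rewrite expr0 invr1; have /andP[? ?] := ternary_set_itv ht.
  by have /andP[? ?] := ternary_set_itv hu; rewrite ler_norml; apply/andP; split; lra.
rewrite !ternary_digitsS => -[tu].
move=> /(IH _ _ (ternary_set_shift ht) (ternary_set_shift hu)).
have -> : ternary_shift t - ternary_shift u = 3 * (t - u).
  by rewrite /ternary_shift !leNgt tu; case: ifP => _; lra.
by rewrite normrM ger0_norm// exprS invfM mulrC -ler_pdivlMr// mulrC.
Qed.

Lemma ternary_close_digits n t u : @ternary_set R t -> @ternary_set R u ->
  `|t - u| < (3 ^+ n)^-1 ->
  mkseq (ternary_digits t) n = mkseq (ternary_digits u) n.
Proof.
elim: n t u => [//|n IH] t u ht hu tun.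
have tu3 : `|t - u| < 3^-1.
  apply: lt_le_trans tun _; rewrite lef_pV2 ?posrE ?exprn_gt0//.
  by rewrite ler_eXnr// ler1n.
have tu : (2^-1 < t) = (2^-1 < u).
  move: tu3; rewrite ltr_norml => /andP[? ?].
  by have [?|?] := ternary_set_gap ht; have [?|?] := ternary_set_gap hu;
    apply/idP/idP; lra.
rewrite !ternary_digitsS tu; congr cons.
apply: IH; [exact: ternary_set_shift|exact: ternary_set_shift|].
have -> : ternary_shift t - ternary_shift u = 3 * (t - u).
  by rewrite /ternary_shift !leNgt tu; case: ifP => _; lra.
rewrite normrM ger0_norm// mulrC -ltr_pdivlMr//.
by rewrite -invfM mulrC -exprS.
Qed.

Lemma pow3V_lt (e : R) : 0 < e -> exists n, (3 ^+ n)^-1 < e.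
Proof.
move=> e0; exists (Num.bound e^-1); rewrite invf_plt ?posrE ?exprn_gt0//.
apply: lt_trans (archi_boundP _) _; first by rewrite invr_ge0 ltW.
by rewrite -natrX ltr_nat ltn_expl.
Qed.

Lemma ternary_digits_inj t u : @ternary_set R t -> @ternary_set R u ->
  (forall n, mkseq (ternary_digits t) n = mkseq (ternary_digits u) n) -> t = u.
Proof.
move=> ht hu h; apply/eqP; rewrite -subr_eq0 -normr_le0.
apply/ler_addgt0Pr => e e0; have [n hn] := pow3V_lt e0.
by rewrite add0r; apply: le_trans (ternary_digits_close ht hu (h n)) (ltW hn).
Qed.

Lemma CD_LYC_not_equicontinuous (Y : Type) (rho : Y -> Y -> R) (g : Y -> Y) :
  Y -> CD_LYC rho g -> ~ equicontinuous_system rho g.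
Proof.
move=> y0 [e [e0 h]] heq.
have [|C [hC hS]] := h (fun=> setT).
  by move=> _; split; [move=> x _; exists 1|exists y0].
have [[f [h' [fC hf _ _]]] _] := hC 0%N.
have C0 : @ternary_set R 0 by move=> n _; exact: ternary_step0.
have C1 : @ternary_set R 1 by move=> n _; exact: ternary_step1.
have inC t : @ternary_set R t -> (\bigcup_(j in [set: nat]) C j) (f t).
  by move=> Ct; exists 0%N => //; rewrite -fC; exists t.
apply: (equicontinuous_not_scrambled e0 heq (inC _ C0) (inC _ C1) _ hS).
move=> /(congr1 h'); rewrite !hf// => /eqP.
by rewrite eq_sym oner_eq0.
Qed.

End Ternary.

(** Cantor's diagonal argument. *)
Lemma cantor_bits (f : (nat -> bool) -> nat) : ~ injective f.
Proof.
move=> finj; pose s n := `[< exists t, f t = n /\ t n = false >].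
have [sT|sF] := boolP (s (f s)).
  by move/asboolP: (sT) => [t [/finj->]]; rewrite sT.
by move: (sF); rewrite {1}/s => /asboolP; apply; exists s; split=> //; exact/negbTE.
Qed.

(** * From scrambled families to chaos *)

Section Transfer.
Context (R : realType) (K : numFieldType) (X : tvsType K) (d : X -> X -> R).
Context (hd : frechet_metric d) (T : {linear X -> X}) (hT : continuous T).
Context (p : nat -> nat) (hp : increasing_positive p).
Context (hexp : expanding_on d T (null_along T p)).
Context (Y : Type) (rho : Y -> Y -> R) (g : Y -> Y).
Context (rho_ge0 : forall y y', 0 <= rho y y') (rho_refl : forall y, rho y y = 0).

Lemma increasing_positive_ge n : (n <= p n)%N.
Proof.
case: hp => _ hmono; elim: n => // n IH.
by apply: leq_ltn_trans IH _; exact: hmono.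
Qed.

Lemma mkseq_neq (s t : nat -> bool) (k l : nat) : (k <= l)%N ->
  mkseq s k != mkseq t k -> mkseq s l != mkseq t l.
Proof.
move=> kl; apply: contra_neq => st; have := congr1 (take k) st.
by rewrite /mkseq -!map_take take_iota (minn_idPl kl).
Qed.

Lemma mkseq_inj (s t : nat -> bool) :
  (forall k, mkseq s k = mkseq t k) -> s = t.
Proof.
move=> h; apply/funext => n; have := congr1 (fun x => nth false x n) (h n.+1).
by rewrite !nth_mkseq.
Qed.

(** A family with the single cluster [0] suffices.  The lower bound is only asked
    below [1], because the endograph metric is bounded by [1]. *)
Lemma U_LYC_of_embedding (phi : X -> Y) :
  (forall n x y e, e <= 1 -> e <= d (iter n T x) (iter n T y) ->
    e <= rho (iter n g (phi x)) (iter n g (phi y))) ->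
  (forall n x y e, d (iter n T x) 0 <= e -> d (iter n T y) 0 <= e ->
    rho (iter n g (phi x)) (iter n g (phi y)) <= 4 * e) ->
  U_LYC rho g.
Proof.
move=> hge hle; have [eps eps0 hz] := expanding_scrambled hd hT hexp.
have [z Hz] := hz (fun=> [:: 0]) (fun=> 1) (fun=> ltr01).
pose f s := phi (z 0%N s).
have m0 : 0 < Num.min eps 1 by rewrite lt_min eps0 ltr01.
have apart s t : s <> t -> forall k0, exists2 n, (k0 <= n)%N &
    Num.min eps 1 <= rho (iter n g (f s)) (iter n g (f t)).
  move=> st k0; have [k hk] : exists k, mkseq s k != mkseq t k.
    apply: contrapT => hn; apply: st; apply: mkseq_inj => k.
    by apply: contrapT => /eqP hk; apply: hn; exists k.
  have [N kN hN] := sf_apart Hz (maxn k0 k).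
  exists N; first by apply: leq_trans (ltnW kN); rewrite leq_maxl.
  apply: hge; first by rewrite ge_min lexx orbT.
  have := hN 0%N 0%N s t (leq0n _) (leq0n _) _ 0 0 (mem_head _ _) (mem_head _ _).
  rewrite !add0r ge_min => -> //.
  by rewrite xpair_eqE eqxx; apply: mkseq_neq hk; rewrite ltnW// ltnS leq_maxr.
have finj : injective f.
  move=> s t fst; apply: contrapT => /apart/(_ 0%N)[n _].
  by rewrite fst rho_refl leNgt m0.
exists (Num.min eps 1); split=> //; exists (range f); split.
  move=> /countable_injP[h hinj]; apply: (@cantor_bits (h \o f)) => s t /= hst.
  by apply: finj; apply: hinj hst; rewrite inE; [exists s|exists t].
move=> _ _ [s _ <-] [t _ <-] fst; split.
  by apply: limn_esup_ge_frequently; apply: apart => st; apply: fst; rewrite st.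
apply: limn_einf_eq0 => // N e e0; have e50 : 0 < e / 5 by rewrite divr_gt0.
have [n Nn hn] := sf_null Hz N e50.
exists (p n); first exact: leq_trans Nn (increasing_positive_ge n).
apply: (@le_lt_trans _ _ (4 * (e / 5))); last by lra.
by apply: hle; apply/ltW/hn.
Qed.

Context (B : Type) (core supp : B -> seq X) (phi : B -> X -> Y).
Context (phi_lip : forall b x y, rho (phi b x) (phi b y) <= d x y).
Context (phi_ge : forall b b' n x y e,
  (forall a a', a \in core b -> a' \in core b' ->
     e <= d (iter n T (a + x)) (iter n T (a' + y))) ->
  e <= rho (iter n g (phi b x)) (iter n g (phi b' y))).
Context (phi_le : forall b b' n x y e,
  d (iter n T x) 0 <= e -> d (iter n T y) 0 <= e ->
  (forall a, a \in supp b -> d (iter n T a) 0 <= e) ->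
  (forall a, a \in supp b' -> d (iter n T a) 0 <= e) ->
  rho (iter n g (phi b x)) (iter n g (phi b' y)) <= 4 * e).
Context (phi_dense : forall U, metric_open rho U -> U !=set0 ->
  exists b (r : R), [/\ 0 < r, forall a, a \in supp b -> null_along T p a &
    forall x, d x 0 < r -> U (phi b x)]).

(** Here [phi b x] stands for the translate by [x] of a base object [b].  Its
    distance to another orbit is bounded below by means of the points of
    [core b], and above by means of the points of [supp b].  The Cantor sets are
    the translates by [z j s], with [s] the digits of a point of the ternary
    set. *)
Lemma CD_LYC_of_translates : CD_LYC rho g.
Proof.
have [eps eps0 hz] := expanding_scrambled hd hT hexp.
exists eps; split=> // U hU.
have /choice[br hbr] : forall j, exists br : B * R,
    [/\ 0 < br.2, forall a, a \in supp br.1 -> null_along T p a &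
      forall x, d x 0 < br.2 -> U j (phi br.1 x)].
  by move=> j; have [oU U0] := hU j; have [b [r ?]] := phi_dense oU U0; exists (b, r).
have [z Hz] := hz (fun j => core (br j).1) (fun j => (br j).2)
  (fun j => let: And3 h _ _ := hbr j in h).
pose f j (t : R) := phi (br j).1 (z j (ternary_digits t)).
have apart j l t u k : (j <= k)%N -> (l <= k)%N ->
    (j, mkseq (ternary_digits t) k.+1) != (l, mkseq (ternary_digits u) k.+1) ->
    (exists2 n, (k <= n)%N & eps <= rho (iter n g (f j t)) (iter n g (f l u))) /\
    (exists2 delta : R, 0 < delta & delta <= rho (f j t) (f l u)).
  move=> jk lk neq; have [N kN hN] := sf_apart Hz k.
  have {}hN := hN j l _ _ jk lk neq; split.
    by exists N; [exact: ltnW|apply: phi_ge => a a'; exact: hN].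
  have [delta delta0 hdelta] := iter_metric2 hd hT N eps0.
  exists delta => //; apply: (phi_ge (n := 0%N)) => a a' /= ac ac'.
  by rewrite leNgt; apply/negP => /hdelta; rewrite ltNge hN.
have digits_neq t u : @ternary_set R t -> @ternary_set R u -> t <> u ->
    exists k, mkseq (ternary_digits t) k != mkseq (ternary_digits u) k.
  move=> Ct Cu tu; apply: contrapT => hn; apply: tu.
  apply: ternary_digits_inj => // k; apply: contrapT => /eqP hk.
  by apply: hn; exists k.
have finj j t u : @ternary_set R t -> @ternary_set R u -> f j t = f j u -> t = u.
  move=> Ct Cu ftu; apply: contrapT => /(digits_neq _ _ Ct Cu)[k hk].
  have [|_ [delta delta0]] := apart j j t u (maxn j k) (leq_maxl _ _) (leq_maxl _ _).
    rewrite xpair_eqE eqxx; apply: mkseq_neq hk.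
    by rewrite ltnW// ltnS leq_maxr.
  by rewrite ftu rho_refl leNgt delta0.
exists (fun j => f j @` @ternary_set R); split=> [j|].
  split; last first.
    move=> _ [t _ <-]; have [_ _ h] := hbr j.
    by apply: h; exact: sf_small Hz j _.
  have /choice[h hh] : forall y, exists t : R,
      (exists2 u, @ternary_set R u & f j u = y) -> @ternary_set R t /\ f j t = y.
    move=> y; have [[u Cu <-]|hn] := pselect (exists2 u, @ternary_set R u & f j u = y).
      by exists u.
    by exists 0.
  exists (f j), h; split=> //.
  - move=> t Ct; have [|Ch fh] := hh (f j t); first by exists t.
    exact: finj fh.
  - move=> t Ct e e0; have [k hk] := sf_cont Hz e0.
    exists (3 ^+ k)^-1; first by rewrite invr_gt0 exprn_gt0.
    move=> u Cu tu; apply: le_lt_trans (phi_lip _ _ _) _; apply: hk.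
    exact: ternary_close_digits.
  move=> _ [t Ct <-] e e0; have [k hk] := pow3V_lt e0.
  have [Ch fh] := hh (f j t) (ex_intro2 _ _ t Ct erefl).
  pose k' := maxn j k.
  (* A single time separates all the prefixes of length [k'.+1], so images that
     are close enough have the same prefix. *)
  have [N _ hN] := sf_apart Hz k'.
  have [delta delta0 hdelta] := iter_metric2 hd hT N eps0.
  exists delta => // _ [u Cu <-] tu.
  have [Cv fv] := hh (f j u) (ex_intro2 _ _ u Cu erefl).
  rewrite (finj _ _ _ Ch Ct fh) (finj _ _ _ Cv Cu fv) /dist_real.
  have [eqd|neqd] := eqVneq (mkseq (ternary_digits t) k'.+1)
                            (mkseq (ternary_digits u) k'.+1).
    apply: le_lt_trans (ternary_digits_close Ct Cu eqd) _; apply: le_lt_trans hk.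
    rewrite lef_pV2 ?posrE ?exprn_gt0// ler_eXn2l ?ltr1n//.
    by rewrite ltnW// ltnS leq_maxr.
  move: tu; rewrite ltNge => /negP[]; apply: (phi_ge (n := 0%N)) => a a' /= ac ac'.
  rewrite leNgt; apply/negP => /hdelta; rewrite ltNge => /negP; apply.
  by apply: hN => //; rewrite ?leq_maxl// xpair_eqE eqxx.
move=> _ _ [j _ [t Ct <-]] [l _ [u Cu <-]] neq; split.
  apply: limn_esup_ge_frequently => N.
  have [k0 hk0] : exists k0, forall k, (k0 <= k)%N ->
      (j, mkseq (ternary_digits t) k.+1) != (l, mkseq (ternary_digits u) k.+1).
    have [jl|jl] := eqVneq j l; last first.
      by exists 0%N => k _; rewrite xpair_eqE negb_and jl.
    have tu : t <> u by move=> tu; apply: neq; rewrite tu jl.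
    have [k0 hk0] := digits_neq _ _ Ct Cu tu; exists k0 => k k0k.
    by rewrite xpair_eqE jl eqxx; apply: mkseq_neq hk0; exact: ltnW.
  pose k := maxn (maxn N k0) (maxn j l).
  have [|||[n kn hn] _] := apart j l t u k.
  - by rewrite /k !leq_max leqnn !orbT.
  - by rewrite /k !leq_max leqnn !orbT.
  - by apply: hk0; rewrite /k !leq_max leqnn !orbT.
  by exists n => //; apply: leq_trans kn; rewrite /k !leq_max leqnn.
apply: limn_einf_eq0 => // N e e0; have e50 : 0 < e / 5 by rewrite divr_gt0.
have nsupp i a : a \in supp (br i).1 -> null_along T p a.
  by have [_ h _] := hbr i; exact: h.
have [N1 hN1] := null_along_seq hd (nsupp j) e50.
have [N2 hN2] := null_along_seq hd (nsupp l) e50.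
pose k := maxn (maxn N (maxn N1 N2)) (maxn j l).
have [n kn hn] := sf_null Hz k e50.
have le_k i : (i <= k)%N -> (i <= n)%N by move=> ik; exact: leq_trans kn.
exists (p n).
  apply: leq_trans (increasing_positive_ge n); apply: le_k.
  by rewrite /k !leq_max leqnn.
apply: (@le_lt_trans _ _ (4 * (e / 5))); last by lra.
apply: phi_le.
- by apply/ltW/hn; rewrite /k !leq_max leqnn !orbT.
- by apply/ltW/hn; rewrite /k !leq_max leqnn !orbT.
- by move=> a ha; apply/ltW/hN1 => //; apply: le_k; rewrite /k !leq_max leqnn !orbT.
- by move=> a ha; apply/ltW/hN2 => //; apply: le_k; rewrite /k !leq_max leqnn !orbT.
Qed.

End Transfer.

(** * Expansion on the vectors with a null suborbit *)

Section Expansion.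
Context (R : realType) (K : numFieldType) (X : tvsType K) (d : X -> X -> R).
Context (hd : frechet_metric d) (T : {linear X -> X}) (hT : continuous T).

Lemma dense_metric (S : set X) : dense S ->
  forall x (e : R), 0 < e -> exists2 y, S y & d x y < e.
Proof.
move=> dS x e e0; have := metric_ball_nbhs hd x e0.
rewrite nbhsE => -[U [oU Ux] UA].
by have [y [Uy Sy]] := dS U (ex_intro _ x Ux) oU; exists y => //; exact: UA.
Qed.

Lemma not_equicontinuous_expanding : ~ equicontinuous_system d T ->
  exists2 e : R, 0 < e & forall delta : R, 0 < delta ->
    exists2 x, d x 0 < delta & exists n, e <= d (iter n T x) 0.
Proof.
move=> neq; apply: contrapT => hno; apply: neq => e e0.
apply: contrapT => hno'; apply: hno; exists e => // delta delta0.
apply: contrapT => hno''; apply: hno'; exists delta => // x y xy n _.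
rewrite ltNge; apply/negP => en; apply: hno''; exists (x - y).
  by rewrite -(metric_sub hd).
by exists n; rewrite iter_linearB -(metric_sub hd).
Qed.

(** Each iterate is continuous, so a small vector with a large iterate can be
    moved into a dense set. *)
Lemma expanding_of_dense (E : set X) : dense E -> ~ equicontinuous_system d T ->
  expanding_on d T E.
Proof.
move=> dE /not_equicontinuous_expanding[e e0 he].
exists (e / 2) => [|delta delta0]; first by rewrite divr_gt0.
have [x xd [n en]] := he _ delta0.
have e20 : 0 < e / 2 by rewrite divr_gt0.
have [t t0 ht] := iter_metric2 hd hT n e20.
have m0 : 0 < Num.min t (delta - d x 0) by rewrite lt_min t0 subr_gt0.
have [y Ey] := dense_metric dE x m0; rewrite lt_min => /andP[/ht xyt xyd].
exists y; split=> //.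
  apply: le_lt_trans (fmetric_triangle hd _ x _) _.
  by rewrite (fmetric_sym hd y) -ltrBrDr.
exists n; have := fmetric_triangle hd (iter n T x) (iter n T y) 0.
by move: xyt en; move: (d _ _) (d _ _) (d _ _) => ? ? ?; lra.
Qed.

Lemma null_along_iter p m x : null_along T p x -> null_along T p (iter m T x).
Proof.
move=> /(null_alongP hd) h; apply/(null_alongP hd) => e e0.
have [t t0 ht] := iter_metric hd hT m e0; have [N hN] := h _ t0.
by exists N => n /hN hn; rewrite -iterD addnC iterD; exact: ht hn.
Qed.

Lemma null_along_sum p n (a : 'I_n -> K) (v : 'I_n -> X) :
  (forall i, null_along T p (v i)) -> null_along T p (\sum_(i < n) a i *: v i).
Proof.
move=> hv; apply: (@big_ind _ (null_along T p)).
- exact: (null_along0 hd).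
- by move=> x y; exact: (null_alongD hd).
- by move=> i _; exact: (null_alongZ hd).
Qed.

(** If a vector has a null suborbit along [p] but its orbit is not null, then
    equicontinuity fails already on the vectors that are null along [p], since
    these contain the whole orbit.  Otherwise every vector of [NS T] has a null
    orbit, so the vectors with a null orbit are dense. *)
Lemma expanding_of_dense_span : dense (linear_span (NS T)) ->
  ~ equicontinuous_system d T ->
  exists2 p, increasing_positive p & expanding_on d T (null_along T p).
Proof.
move=> dNS neq.
have [[x [[p hp px] nx]]|hno] :=
    pselect (exists x, NS T x /\ ~ null_along T succn x); last first.
  exists succn; first by split=> // i j; rewrite ltnS.
  apply: expanding_of_dense neq => U U0 oU.
  have [y [Uy [n [a [v [hv yE]]]]]] := dNS U U0 oU.
  exists y; split=> //; rewrite yE.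
  apply: null_along_sum => i; apply: contrapT => hn; apply: hno.
  by exists (v i).
exists p => //; apply: contrapT => hexp; apply: nx; apply/(null_alongP hd) => e e0.
have [delta delta0 hdelta] : exists2 delta : R, 0 < delta & forall y,
    null_along T p y -> d y 0 < delta -> forall n, d (iter n T y) 0 < e.
  apply: contrapT => hn; apply: hexp; exists e => // delta delta0.
  apply: contrapT => hn'; apply: hn; exists delta => // y py yd n.
  by rewrite ltNge; apply/negP => en; apply: hn'; exists y; split=> //; exists n.
have /(null_alongP hd)/(_ _ delta0)[N hN] := px.
exists (p N) => n pNn; have -> : n.+1 = (n.+1 - p N + p N)%N by rewrite subnK// leqW.
by rewrite iterD; apply: hdelta; [exact: null_along_iter|exact: hN].
Qed.

End Expansion.

(** * The Hausdorff distance *)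

Lemma sup_ge0 (R : realType) (E : set R) : (forall x, E x -> 0 <= x) -> 0 <= sup E.
Proof.
move=> E0; have [[[x Ex] bE]|hE] := pselect (has_sup E); last by rewrite sup_out.
by apply: le_trans (E0 x Ex) _; exact: ub_le_sup.
Qed.

Section Hausdorff.
Context (R : realType) (Y : Type) (rho : Y -> Y -> R).
Context (rho_ge0 : forall x y, 0 <= rho x y).
Implicit Types (A B : set Y) (e : R).

(** Avoids the infima of the Hausdorff distance, which the bounds [hausdorff_le]
    and [hausdorff_lt] relate to it. *)
Definition within_dist e A B : Prop :=
  (forall a, A a -> exists2 b, B b & rho a b <= e) /\
  (forall b, B b -> exists2 a, A a & rho b a <= e).

Lemma within_dist_refl e A : (forall x, rho x x = 0) -> 0 <= e -> within_dist e A A.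
Proof. by move=> rho0 e0; split=> a Aa; exists a; rewrite ?rho0. Qed.

Lemma inf_dist_ge0 x B : 0 <= inf [set rho x b | b in B].
Proof.
have [[b Bb]|B0] := pselect (B !=set0).
  by apply: lb_le_inf => [|y [c _ <-]]; first by exists (rho x b), b.
have -> : [set rho x b | b in B] = set0.
  by apply/seteqP; split=> // y [b Bb _]; apply: B0; exists b.
by rewrite inf0.
Qed.

Lemma inf_dist_le x B b : B b -> inf [set rho x b | b in B] <= rho x b.
Proof. by move=> Bb; apply: ge_inf; [exists 0 => _ [c _ <-]|exists b]. Qed.

Lemma hausdorff_ge0 A B : 0 <= hausdorff_dist rho A B.
Proof.
rewrite le_max; apply/orP; left.
by apply: sup_ge0 => x [a Aa <-]; exact: inf_dist_ge0.
Qed.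

Lemma hausdorff_le e A B : A !=set0 -> B !=set0 ->
  within_dist e A B -> hausdorff_dist rho A B <= e.
Proof.
move=> [a0 Aa0] [b0 Bb0] [AB BA]; rewrite ge_max; apply/andP; split.
  apply: ge_sup; first by exists (inf [set rho a0 b | b in B]), a0.
  move=> _ [a Aa <-]; have [b Bb ab] := AB a Aa.
  exact: le_trans (inf_dist_le _ Bb) ab.
apply: ge_sup; first by exists (inf [set rho b0 a | a in A]), b0.
move=> _ [b Bb <-]; have [a Aa ba] := BA b Bb.
exact: le_trans (inf_dist_le _ Aa) ba.
Qed.

(** The hypothesis [within_dist M A B] keeps the suprema away from the default
    value of an unbounded set. *)
Lemma hausdorff_lt M e A B : A !=set0 -> B !=set0 -> within_dist M A B ->
  hausdorff_dist rho A B < e ->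
  (forall a, A a -> exists2 b, B b & rho a b < e) /\
  (forall b, B b -> exists2 a, A a & rho b a < e).
Proof.
move=> [a0 Aa0] [b0 Bb0] [AB BA]; rewrite gt_max => /andP[h1 h2].
split=> [a Aa|b Bb].
  have [||_ [b Bb <-] abe] := @inf_lt _ [set rho a b | b in B] e.
  - by exists (rho a b0), b0.
  - apply: le_lt_trans h1; apply: ub_le_sup; last by exists a.
    exists M => _ [c Ac <-]; have [b Bb cb] := AB c Ac.
    exact: le_trans (inf_dist_le _ Bb) cb.
  by exists b.
have [||_ [a Aa <-] bae] := @inf_lt _ [set rho b a | a in A] e.
- by exists (rho b a0), a0.
- apply: le_lt_trans h2; apply: ub_le_sup; last by exists b.
  exists M => _ [c Bc <-]; have [a Aa ca] := BA c Bc.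
  exact: le_trans (inf_dist_le _ Aa) ca.
by exists a.
Qed.

Lemma hausdorff_ge M e A B a : within_dist M A B ->
  A a -> B !=set0 -> (forall b, B b -> e <= rho a b) ->
  e <= hausdorff_dist rho A B.
Proof.
move=> AB Aa B0 h; rewrite leNgt; apply/negP => lt.
have [/(_ a Aa)[b Bb]] := hausdorff_lt (ex_intro _ a Aa) B0 AB lt.
by rewrite ltNge h.
Qed.

End Hausdorff.

(** * The hyperspace of compact sets *)

Section Compact.
Context (R : realType) (K : numFieldType) (X : tvsType K) (d : X -> X -> R).
Context (hd : frechet_metric d).

Lemma compact_net (A D : set X) (e : R) : compact A -> dense D -> 0 < e ->
  exists xs : seq X, [/\ forall x, x \in xs -> D x,
    forall y, A y -> exists2 x, x \in xs & d y x < e &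
    forall x, x \in xs -> exists2 y, A y & d x y < e].
Proof.
move=> cpA dD e0.
(* The origin serves as base point for the covering criterion. *)
pose Xp : ptopologicalType := HB.pack X (isPointed.Build X 0).
have cA : @cover_compact X A by rewrite -(@compact_cover Xp).
have e20 : 0 < e / 2 by rewrite divr_gt0.
have /choice[q hq] : forall x, exists y, D y /\ d x y < e / 2.
  by move=> x; have [y Dy xy] := dense_metric hd dD x e20; exists y.
have [||F FA cF] := cA X A (fun x => interior [set y | d x y < e / 2]).
- by move=> x _; exact: open_interior.
- by move=> x Ax; exists x => //; exact: metric_ball_nbhs.
exists [seq q x | x <- finmap.enum_fset F]; split.
- by move=> _ /mapP[x _ ->]; have [] := hq x.
- move=> y /cF[x /= xF /interior_subset/= xy]; exists (q x).
    exact: map_f.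
  apply: le_lt_trans (fmetric_triangle hd _ x _) _; rewrite [ltRHS]splitr.
  by rewrite (fmetric_sym hd y) ltrD//; have [] := hq x.
move=> _ /mapP[x xF ->]; have [_ xq] := hq x; exists x.
  by have := FA x xF; rewrite inE.
rewrite (fmetric_sym hd); apply: lt_le_trans xq _.
by rewrite ler_pdivrMr// ler_pMr// ler1n.
Qed.

Lemma compact_bounded_metric (A : set X) : compact A ->
  exists M : R, forall x, A x -> d x 0 <= M.
Proof.
move=> cA; have dT : dense [set: X] by move=> U [x Ux] _; exists x.
have [xs [_ hxs _]] := compact_net cA dT ltr01.
have [M hM] : exists M : R, forall x, x \in xs -> d x 0 <= M.
  elim: {hxs} xs => [|x xs [M hM]]; first by exists 0.
  exists (Num.max M (d x 0)) => y; rewrite inE le_max => /predU1P[->|/hM->//].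
  by rewrite lexx orbT.
exists (1 + M) => y /hxs[x xxs yx].
by apply: le_trans (fmetric_triangle hd _ x _) _; rewrite lerD ?hM// ltW.
Qed.

Lemma compact_within_dist (A B : set X) : compact A -> compact B ->
  exists M : R, forall A' B', A' `<=` A -> B' `<=` B ->
  A' !=set0 -> B' !=set0 -> within_dist d M A' B'.
Proof.
move=> /compact_bounded_metric[M hM] /compact_bounded_metric[N hN].
exists (M + N) => A' B' AA BB [a Aa] [b Bb]; split=> [x Ax|x Bx].
  exists b => //; apply: le_trans (fmetric_triangle hd _ 0 _) _.
  by rewrite (fmetric_sym hd 0) lerD ?hM ?hN//; [exact: AA|exact: BB].
exists a => //; apply: le_trans (fmetric_triangle hd _ 0 _) _.
by rewrite (fmetric_sym hd 0) addrC lerD ?hM ?hN//; [exact: AA|exact: BB].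
Qed.

Context (T : {linear X -> X}) (hT : continuous T).

Lemma iter_hyper_map n (A : hyperspace X) :
  sval (iter n (hyper_map hT) A) = iter n T @` sval A.
Proof.
elim: n => [|n IH] /=; first by rewrite image_id.
by rewrite IH image_comp.
Qed.

Lemma hyper_nonempty (A : hyperspace X) : sval A !=set0.
Proof. by case: (svalP A). Qed.

Lemma hyper_within (A B : hyperspace X) : exists M : R, within_dist d M (sval A) (sval B).
Proof.
have [M hM] := compact_within_dist (proj1 (svalP A)) (proj1 (svalP B)).
by exists M; apply: hM => //; exact: hyper_nonempty.
Qed.

Lemma hyper_dist_ge0 (A B : hyperspace X) : 0 <= hyper_dist d A B.
Proof. exact/hausdorff_ge0/(fmetric_ge0 hd). Qed.

Lemma hyper_dist_le e (A B : hyperspace X) :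
  within_dist d e (sval A) (sval B) -> hyper_dist d A B <= e.
Proof.
by apply: hausdorff_le; [exact: (fmetric_ge0 hd)|exact: hyper_nonempty..].
Qed.

Lemma hyper_dist_refl (A : hyperspace X) : hyper_dist d A A = 0.
Proof.
apply/eqP; rewrite eq_le hyper_dist_ge0 andbT; apply: hyper_dist_le.
by apply: within_dist_refl => //; exact: metric_refl.
Qed.

Lemma within_dist_iter e (delta : R) n (A B : set X) :
  (forall x y, d x y < delta -> d (iter n T x) (iter n T y) < e) ->
  (forall a, A a -> exists2 b, B b & d a b < delta) /\
  (forall b, B b -> exists2 a, A a & d b a < delta) ->
  within_dist d e (iter n T @` A) (iter n T @` B).
Proof.
move=> h [AB BA]; split=> _ [x hx <-].
  by have [y By /h/ltW ?] := AB x hx; exists (iter n T y) => //; exists y.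
by have [y By /h/ltW ?] := BA x hx; exists (iter n T y) => //; exists y.
Qed.

Lemma equicontinuous_hyper :
  equicontinuous_system d T -> equicontinuous_system (hyper_dist d) (hyper_map hT).
Proof.
move=> heq e e0; have e20 : 0 < e / 2 by rewrite divr_gt0.
have [delta delta0 h] := heq _ e20; exists delta => // A B AB n n0.
have [M hM] := hyper_within A B.
apply: (@le_lt_trans _ _ (e / 2)); last by rewrite ltr_pdivrMr// ltr_pMr// ltr1n.
apply: hyper_dist_le; rewrite !iter_hyper_map.
apply: (within_dist_iter (fun x y xy => h x y xy n n0)).
exact: (hausdorff_lt (fmetric_ge0 hd) (hyper_nonempty A) (hyper_nonempty B) hM AB).
Qed.

(** A nonempty finite set is encoded by an element and the list of the others. *)
Definition finite_translate (b : X * seq X) (z : X) : set X :=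
  [set` [seq x + z | x <- b.1 :: b.2]].

Lemma finite_translateP b z y :
  finite_translate b z y <-> exists2 x, x \in b.1 :: b.2 & y = x + z.
Proof. by split=> [/mapP//|h]; exact/mapP. Qed.

Lemma finite_translate_hyper b z :
  compact (finite_translate b z) /\ finite_translate b z !=set0.
Proof.
split; first by apply: finite_compact; exact: finite_seq.
by exists (b.1 + z); apply/finite_translateP; exists b.1; rewrite ?mem_head.
Qed.

Definition hyper_translate b z : hyperspace X := exist _ _ (finite_translate_hyper b z).

Let pts (b : X * seq X) : seq X := b.1 :: b.2.

Lemma hyper_translate_lip b x y :
  hyper_dist d (hyper_translate b x) (hyper_translate b y) <= d x y.
Proof.
apply: hyper_dist_le; split=> _ /finite_translateP[a ab ->].
  exists (a + y); first by apply/finite_translateP; exists a.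
  by rewrite (metric_addr hd).
exists (a + x); first by apply/finite_translateP; exists a.
by rewrite (metric_addr hd) (fmetric_sym hd).
Qed.

Lemma hyper_translate_ge b b' n x y e :
  (forall a a', a \in pts b -> a' \in pts b' ->
     e <= d (iter n T (a + x)) (iter n T (a' + y))) ->
  e <= hyper_dist d (iter n (hyper_map hT) (hyper_translate b x))
                    (iter n (hyper_map hT) (hyper_translate b' y)).
Proof.
move=> h; have [M hM] := hyper_within (iter n (hyper_map hT) (hyper_translate b x))
   (iter n (hyper_map hT) (hyper_translate b' y)).
apply: (hausdorff_ge (fmetric_ge0 hd) hM (a := iter n T (b.1 + x))).
- rewrite iter_hyper_map; exists (b.1 + x) => //.
  by apply/finite_translateP; exists b.1; rewrite ?mem_head.
- exact: hyper_nonempty.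
rewrite iter_hyper_map => _ [_ /finite_translateP[a' a'b ->] <-].
by apply: h => //; exact: mem_head.
Qed.

Lemma metric_orbit_le n a x a' y e :
  d (iter n T x) 0 <= e -> d (iter n T y) 0 <= e ->
  d (iter n T a) 0 <= e -> d (iter n T a') 0 <= e ->
  d (iter n T (a + x)) (iter n T (a' + y)) <= 4 * e.
Proof.
move=> hx hy ha ha'; apply: le_trans (fmetric_triangle hd _ 0 _) _.
rewrite (fmetric_sym hd 0) !iter_linearD.
have := metric0_add hd (iter n T a) (iter n T x).
have := metric0_add hd (iter n T a') (iter n T y).
move: hx hy ha ha'; do 6 move: (d _ _) => ?.
lra.
Qed.

Lemma hyper_translate_le b b' n x y e :
  d (iter n T x) 0 <= e -> d (iter n T y) 0 <= e ->
  (forall a, a \in pts b -> d (iter n T a) 0 <= e) ->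
  (forall a, a \in pts b' -> d (iter n T a) 0 <= e) ->
  hyper_dist d (iter n (hyper_map hT) (hyper_translate b x))
               (iter n (hyper_map hT) (hyper_translate b' y)) <= 4 * e.
Proof.
move=> hx hy hb hb'; apply: hyper_dist_le; rewrite !iter_hyper_map.
split=> _ [_ /finite_translateP[a ab ->] <-].
  exists (iter n T (b'.1 + y)).
    exists (b'.1 + y) => //.
    by apply/finite_translateP; exists b'.1; rewrite ?mem_head.
  by apply: metric_orbit_le => //; [exact: hb|apply: hb'; exact: mem_head].
exists (iter n T (b.1 + x)).
  exists (b.1 + x) => //.
  by apply/finite_translateP; exists b.1; rewrite ?mem_head.
by apply: metric_orbit_le => //; [exact: hb'|apply: hb; exact: mem_head].
Qed.

Lemma hyper_translate_dense (D : set X) (U : set (hyperspace X)) : dense D ->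
  metric_open (hyper_dist d) U -> U !=set0 ->
  exists b (r : R), [/\ 0 < r, forall a, a \in pts b -> D a &
    forall x, d x 0 < r -> U (hyper_translate b x)].
Proof.
move=> dD oU [A UA]; have [r r0 hr] := oU A UA.
have r30 : 0 < r / 3 by rewrite divr_gt0.
have [cA [a0 Aa0]] := svalP A.
have [xs [xsD Axs xsA]] := compact_net cA dD r30.
case: xs xsD Axs xsA => [_ Axs|x0 xs xsD Axs xsA]; first by have [] := Axs a0 Aa0.
exists (x0, xs), (r / 3); split=> // x xr; apply: hr => /=.
apply: (@le_lt_trans _ _ (r / 3 + r / 3)); last by lra.
apply: hyper_dist_le; split=> [y /Axs[a axs ya]|_ /finite_translateP[a /xsA[y Ay ay] ->]].
  exists (a + x); first by apply/finite_translateP; exists a.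
  apply: le_trans (fmetric_triangle hd _ a _) _; rewrite lerD ?ltW//.
  by rewrite (fmetric_sym hd) (metric_sub hd) addrAC subrr add0r.
exists y => //; apply: le_trans (fmetric_triangle hd _ a _) _.
by rewrite lerD ?ltW// (metric_sub hd) addrAC subrr add0r.
Qed.

End Compact.

(** * Fuzzy sets through their level sets *)

(** Composing with [xi] renumbers the positive levels by the inverse [zeta] and
    fixes the levels [0] and [1]. *)
Lemma increasing_homeo_level (R : realType) (xi : R -> R) : increasing_homeo xi ->
  exists2 zeta : R -> R,
    (forall a, 0 < a <= 1 -> 0 < zeta a <= 1 /\
      forall b, 0 <= b <= 1 -> (a <= xi b) = (zeta a <= b)) &
    xi 0 = 0 /\ (forall b, 0 <= b <= 1 -> 0 <= xi b <= 1 /\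
      (0 < xi b) = (0 < b)) /\ xi 1 = 1.
Proof.
move=> [hmono [zeta [hxi hzeta _ _]]].
have xiI b : 0 <= b <= 1 -> 0 <= xi b <= 1.
  by move=> hb; have [] := hxi b; rewrite in_itv//= in_itv.
have zetaI b : 0 <= b <= 1 -> 0 <= zeta b <= 1.
  by move=> hb; have [] := hzeta b; rewrite in_itv//= in_itv.
have xiK b : 0 <= b <= 1 -> xi (zeta b) = b.
  by move=> hb; have [] := hzeta b; rewrite in_itv.
have mono a b : 0 <= a <= 1 -> 0 <= b <= 1 -> a < b -> xi a < xi b.
  by move=> ha hb ab; apply: hmono; rewrite ?in_itv.
have h01 : 0 <= (0 : R) <= 1 by rewrite lexx ler01.
have h11 : 0 <= (1 : R) <= 1 by rewrite lexx ler01.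
have xi0 : xi 0 = 0.
  have /andP[z0 _] := zetaI 0 h01; move: z0; rewrite le_eqVlt => /predU1P[z0|z0].
    by rewrite z0 xiK.
  have := mono _ _ h01 (zetaI 0 h01) z0; rewrite xiK// ltNge.
  by have /andP[-> _] := xiI 0 h01.
have xi1 : xi 1 = 1.
  have /andP[_ z1] := zetaI 1 h11; move: z1; rewrite le_eqVlt => /predU1P[z1|z1].
    by rewrite -[in LHS]z1 xiK.
  have := mono _ _ (zetaI 1 h11) h11 z1; rewrite xiK// ltNge.
  by have /andP[_ ->] := xiI 1 h11.
have le_xi a b : 0 <= a <= 1 -> 0 <= b <= 1 -> (a <= xi b) = (zeta a <= b).
  move=> ha hb; apply/idP/idP; last first.
    rewrite le_eqVlt => /predU1P[<-|zb]; first by rewrite xiK.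
    by rewrite -[leLHS]xiK// ltW// mono// zetaI.
  by apply: contraTT; rewrite -!ltNge => bz; rewrite -[ltRHS]xiK// mono// zetaI.
exists zeta => [a /andP[a0 a1]|].
  have ha : 0 <= a <= 1 by rewrite ltW.
  have /andP[z0 z1] := zetaI a ha; split; last by move=> b hb; exact: le_xi.
  rewrite z1 andbT lt_def z0 andbT; apply: contraTneq a0 => za.
  by rewrite -(xiK a ha) za xi0 ltxx.
split=> //; split=> // b hb; split; first exact: xiI.
have /andP[b0 _] := hb; move: b0; rewrite le_eqVlt => /predU1P[<-|b0].
  by rewrite xi0.
by rewrite b0 -[ltLHS]xi0; apply: mono.
Qed.

Section Fuzzy.
Context (R : realType) (K : numFieldType) (X : tvsType K) (d : X -> X -> R).
Context (hd : frechet_metric d).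
Implicit Types (u v w : fuzzy R X) (e a b : R).

Lemma fuzzy_ge0 u x : 0 <= sval u x.
Proof. by case: (svalP u) => h _ _ _; case/andP: (h x). Qed.

Lemma fuzzy_le1 u x : sval u x <= 1.
Proof. by case: (svalP u) => h _ _ _; case/andP: (h x). Qed.

Lemma fuzzy_one u : exists x, 1 <= sval u x.
Proof.
by case: (svalP u) => _ _ _ [x]; rewrite level_pos ?ltr01//; exists x.
Qed.

Lemma sub_level0 u a : 0 <= a -> level (sval u) a `<=` level (sval u) 0.
Proof.
rewrite le_eqVlt => /predU1P[<-//|a0]; rewrite level_pos//.
rewrite [X in _ `<=` X]/level eqxx => x /= ax; apply: subset_closure => /=.
exact: lt_le_trans ax.
Qed.

Lemma level_nonempty u a : 0 <= a <= 1 -> level (sval u) a !=set0.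
Proof.
move=> /andP[a0 a1]; have [x x1] := fuzzy_one u.
move: a0; rewrite le_eqVlt => /predU1P[<-|a0]; exists x; last first.
  by rewrite level_pos//=; exact: le_trans x1.
apply: (@sub_level0 u 1) => //; rewrite level_pos//.
Qed.

Lemma level0_pos u x : 0 < sval u x -> level (sval u) 0 x.
Proof. by move=> ux; rewrite /level eqxx; apply: subset_closure. Qed.

Lemma level0_near u x e : 0 < e -> level (sval u) 0 x ->
  exists2 y, 0 < sval u y & d x y < e.
Proof.
move=> e0; rewrite /level eqxx => cx.
by have [y [/= uy xy]] := cx _ (metric_ball_nbhs hd x e0); exists y.
Qed.

Lemma fuzzy_within u v : exists M : R, forall A B,
  A `<=` level (sval u) 0 -> B `<=` level (sval v) 0 ->
  A !=set0 -> B !=set0 -> within_dist d M A B.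
Proof.
case: (svalP u) => _ _ cu _; case: (svalP v) => _ _ cv _.
exact: (compact_within_dist hd cu cv).
Qed.

(** Closeness for the supremum metric, without the level [0]; it bounds all four
    metrics. *)
Definition level_close e u v : Prop := forall a, 0 < a <= 1 ->
  within_dist d e [set x | a <= sval u x] [set x | a <= sval v x].

Lemma level_close_refl e u : 0 <= e -> level_close e u u.
Proof. by move=> e0 a _; apply: within_dist_refl => //; exact: metric_refl. Qed.

Lemma level_close_trans e e' u v w :
  level_close e u v -> level_close e' v w -> level_close (e + e') u w.
Proof.
move=> uv vw a a01; have [uv1 uv2] := uv a a01; have [vw1 vw2] := vw a a01.
split=> x ax.
  have [y ay xy] := uv1 x ax; have [z az yz] := vw1 y ay; exists z => //.
  by apply: le_trans (fmetric_triangle hd _ y _) _; exact: lerD.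
have [y ay xy] := vw2 x ax; have [z az yz] := uv2 y ay; exists z => //.
by apply: le_trans (fmetric_triangle hd _ y _) _; rewrite addrC; exact: lerD.
Qed.

(** The level at [0] is the closure of the union of the others, hence is
    controlled by them up to an arbitrarily small error. *)
Lemma level_close_hausdorff e u v a : level_close e u v -> 0 <= a <= 1 ->
  hausdorff_dist d (level (sval u) a) (level (sval v) a) <= e.
Proof.
move=> uv /andP[a0 a1].
have uvn := (level_nonempty u (a := a), level_nonempty v (a := a)).
rewrite a0 a1 in uvn.
move: a0; rewrite le_eqVlt => /predU1P[a00|a0]; last first.
  apply: (hausdorff_le (fmetric_ge0 hd)); [exact: uvn.1|exact: uvn.2|].
  by rewrite !level_pos//; apply: uv; rewrite a0.
apply/ler_addgt0Pr => delta delta0.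
apply: (hausdorff_le (fmetric_ge0 hd)); [exact: uvn.1|exact: uvn.2|].
rewrite -a00; split=> x /(level0_near delta0)[y yp xy].
  have [|uv1 _] := uv (sval u y); first by rewrite yp fuzzy_le1.
  have [z yz dyz] := uv1 y (lexx _); exists z.
    by apply: level0_pos; exact: lt_le_trans yp yz.
  by apply: le_trans (fmetric_triangle hd _ y _) _; rewrite addrC lerD// ltW.
have [|_ uv2] := uv (sval v y); first by rewrite yp fuzzy_le1.
have [z yz dyz] := uv2 y (lexx _); exists z.
  by apply: level0_pos; exact: lt_le_trans yp yz.
by apply: le_trans (fmetric_triangle hd _ y _) _; rewrite addrC lerD// ltW.
Qed.

Lemma d_infty_le e u v : level_close e u v -> d_infty d (sval u) (sval v) <= e.
Proof.
move=> uv; apply: ge_sup.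
  exists (hausdorff_dist d (level (sval u) 0) (level (sval v) 0)), 0 => //=.
  by rewrite in_itv/= lexx ler01.
by move=> _ [a /= ha <-]; apply: level_close_hausdorff => //; rewrite in_itv in ha.
Qed.

Lemma hausdorff_le_d_infty u v a : 0 <= a <= 1 ->
  hausdorff_dist d (level (sval u) a) (level (sval v) a) <=
  d_infty d (sval u) (sval v).
Proof.
move=> a01; have [M hM] := fuzzy_within u v.
apply: ub_le_sup; last by exists a => //=; rewrite in_itv.
exists M => _ [b /= hb <-]; rewrite in_itv/= in hb; have /andP[b0 _] := hb.
apply: (hausdorff_le (fmetric_ge0 hd)); [exact: level_nonempty..|].
by apply: hM; [exact: sub_level0|exact: sub_level0|exact: level_nonempty..].
Qed.

Lemma d_infty_lt e u v a : 0 < a <= 1 -> d_infty d (sval u) (sval v) < e ->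
  (forall x, a <= sval u x -> exists2 y, a <= sval v y & d x y < e) /\
  (forall y, a <= sval v y -> exists2 x, a <= sval u x & d y x < e).
Proof.
move=> /andP[a0 a1] uve; have [M hM] := fuzzy_within u v.
have a01 : 0 <= a <= 1 by rewrite ltW.
have uvn := (level_nonempty u a01, level_nonempty v a01).
have := hausdorff_lt (fmetric_ge0 hd) uvn.1 uvn.2
  (hM _ _ (sub_level0 (ltW a0)) (sub_level0 (ltW a0)) uvn.1 uvn.2)
  (le_lt_trans (hausdorff_le_d_infty u v a01) uve).
by rewrite !level_pos.
Qed.

Lemma d_infty_ge e u v :
  (forall x y, 1 <= sval u x -> 1 <= sval v y -> e <= d x y) ->
  e <= d_infty d (sval u) (sval v).
Proof.
move=> h; rewrite leNgt; apply/negP => lt; have [x x1] := fuzzy_one u.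
have [|/(_ x x1)[y y1]] := d_infty_lt (a := 1) _ lt; first by rewrite lexx ltr01.
by rewrite ltNge h.
Qed.

Lemma d_infty_ge0 u v : 0 <= d_infty d (sval u) (sval v).
Proof. by apply: d_infty_ge => x y _ _; exact: (fmetric_ge0 hd). Qed.

(** ** Reparametrized levels *)

Lemma homeo_fuzzy_subproof xi u : increasing_homeo xi -> is_fuzzy (xi \o sval u).
Proof.
move=> hxi; have [zeta hz [xi0 [hx xi1]]] := increasing_homeo_level hxi.
have [u01 us uc u1] := svalP u; split.
- by move=> x; have [] := hx _ (u01 x).
- move=> x a /= xa; have [a1|a1] := leP a 1; last first.
    by apply: nearW => y; apply: le_lt_trans a1; have [/andP[]] := hx _ (u01 y).
  have a0 : 0 < a by apply: le_lt_trans xa; have [/andP[]] := hx _ (u01 x).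
  have [|_ hza] := hz a; first by rewrite a0.
  move: xa; rewrite ltNge hza// -ltNge => /us; apply: filterS => y.
  by rewrite ltNge -hza// -ltNge.
- move: uc; rewrite /level eqxx; congr (compact (closure _)).
  apply/seteqP; split=> x /=; have [_ h] := hx _ (u01 x); first by rewrite h.
  by rewrite h.
have [x x1] := fuzzy_one u; exists x.
by rewrite level_pos//= (@le_anti _ _ (sval u x) 1) ?xi1// x1 fuzzy_le1.
Qed.

Definition homeo_fuzzy xi (hxi : increasing_homeo xi) u : fuzzy R X :=
  exist _ _ (homeo_fuzzy_subproof u hxi).

Lemma increasing_homeo_id : increasing_homeo (@id R).
Proof.
split; first by [].
by exists id; split=> // [|]; apply: continuous_subspaceT => x; exact: cvg_id.
Qed.

Lemma sup_homeo_id : sup [set `|id a - a| | a in `[(0 : R), 1]] = 0.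
Proof.
have -> : [set `|id a - a| | a in `[(0 : R), 1]] = [set 0].
  apply/seteqP; split=> [_ [a _ <-]|_ ->]; first by rewrite subrr normr0.
  by exists 0; [rewrite /= in_itv/= lexx ler01|rewrite subrr normr0].
by rewrite sup1.
Qed.

Lemma d_0_le_homeo xi u v e : increasing_homeo xi -> 0 < e ->
  sup [set `|xi a - a| | a in `[0, 1]] <= e ->
  d_infty d (sval u) (xi \o sval v) <= e -> d_0 d (sval u) (sval v) <= e.
Proof.
move=> hxi e0 xie uve; apply: ge_inf; first by exists 0 => a [/ltW].
by split=> //; exists xi.
Qed.

Lemma d_0_le e u v : 0 <= e -> level_close e u v -> d_0 d (sval u) (sval v) <= e.
Proof.
move=> e0 uv; apply/ler_addgt0Pr => delta delta0.
have ed0 : 0 < e + delta by rewrite ltr_wpDl.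
apply: (d_0_le_homeo increasing_homeo_id) => //.
  by rewrite sup_homeo_id ltW.
by apply: le_trans (d_infty_le uv) _; rewrite lerDl ltW.
Qed.

Lemma d_0_nonempty u v :
  [set e : R | 0 < e /\ exists xi : R -> R, [/\ increasing_homeo xi,
     sup [set `|xi a - a| | a in `[0, 1]] <= e
     & d_infty d (sval u) (xi \o sval v) <= e]] !=set0.
Proof.
exists (d_infty d (sval u) (sval v) + 1); have h := d_infty_ge0 u v.
split; first by rewrite ltr_wpDl.
exists id; split; [exact: increasing_homeo_id| |by rewrite lerDl].
by rewrite sup_homeo_id addr_ge0.
Qed.

(** Every admissible reparametrization fixes the level [1]. *)
Lemma d_0_ge e u v :
  (forall x y, 1 <= sval u x -> 1 <= sval v y -> e <= d x y) ->
  e <= d_0 d (sval u) (sval v).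
Proof.
move=> h; apply: lb_le_inf; first exact: d_0_nonempty.
move=> r [r0 [xi [hxi _]]]; apply: le_trans.
apply: (@d_infty_ge e u (homeo_fuzzy hxi v)) => x y ux /= vy; apply: h => //.
have [zeta _ [_ [hx xi1]]] := increasing_homeo_level hxi.
rewrite leNgt; apply/negP => v1; move: vy; rewrite leNgt -[ltRHS]xi1.
case: hxi => hmono _; rewrite hmono// in_itv/= ?lexx ?ler01//.
by rewrite fuzzy_ge0 fuzzy_le1.
Qed.

Lemma d_0_ge0 u v : 0 <= d_0 d (sval u) (sval v).
Proof. by apply: d_0_ge => x y _ _; exact: (fmetric_ge0 hd). Qed.

(** ** Endographs *)

Lemma dbar_ge0 (p q : X * R) : 0 <= dbar d p q.
Proof. by rewrite le_max (fmetric_ge0 hd). Qed.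

Lemma dbar_refl (p : X * R) : dbar d p p = 0.
Proof. by rewrite /dbar (metric_refl hd) subrr normr0 maxxx. Qed.

Lemma d_E_ge0 u v : 0 <= d_E d (sval u) (sval v).
Proof. exact: hausdorff_ge0 dbar_ge0 _ _. Qed.

Lemma d_S_ge0 u v : 0 <= d_S d (sval u) (sval v).
Proof. exact: hausdorff_ge0 dbar_ge0 _ _. Qed.

Lemma endograph0 u x : endograph (sval u) (x, 0).
Proof. by split; rewrite /= ?lexx ?ler01// fuzzy_ge0. Qed.

Lemma endograph_nonempty u : endograph (sval u) !=set0.
Proof. by exists (0, 0); exact: endograph0. Qed.

Lemma sendograph_pos u x a : 0 < a -> a <= sval u x -> sendograph (sval u) (x, a).
Proof.
move=> a0 ax; have a1 := le_trans ax (fuzzy_le1 u x).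
split; first by split; rewrite /= ?(ltW a0).
split; last by rewrite /= in_itv/= ltW.
by apply: level0_pos; exact: lt_le_trans ax.
Qed.

Lemma sendograph0 u x : level (sval u) 0 x -> sendograph (sval u) (x, 0).
Proof.
move=> ux; split; first exact: endograph0.
by split=> //=; rewrite in_itv/= lexx ler01.
Qed.

Lemma sendograph_nonempty u : sendograph (sval u) !=set0.
Proof.
have [x x1] := fuzzy_one u; exists (x, 1); exact: sendograph_pos.
Qed.

Lemma endograph_within u v :
  within_dist (dbar d) 1 (endograph (sval u)) (endograph (sval v)).
Proof.
have h x a : 0 <= a <= 1 -> dbar d (x, a) (x, 0) <= 1.
  by move=> /andP[a0 a1]; rewrite /dbar/= (metric_refl hd) subr0 ger0_norm// ge_max ler01.
by split=> -[x a] [/= a01 _]; exists (x, 0); rewrite ?h//; exact: endograph0.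
Qed.

Lemma sendograph_within u v : exists M : R,
  within_dist (dbar d) M (sendograph (sval u)) (sendograph (sval v)).
Proof.
have [M hM] := fuzzy_within u v.
have h01 : 0 <= (0 : R) <= 1 by rewrite lexx ler01.
have [uv vu] := hM _ _ (@subset_refl _ _) (@subset_refl _ _)
  (level_nonempty u h01) (level_nonempty v h01).
have h x y a : 0 <= a <= 1 -> d x y <= M -> dbar d (x, a) (y, 0) <= Num.max M 1.
  move=> /andP[a0 a1] xy; rewrite /dbar/= subr0 ger0_norm// ge_max !le_max xy a1.
  by rewrite orbT.
exists (Num.max M 1); split=> -[x a] [[/= a01 _] [/= x0 _]].
  by have [y y0 xy] := uv x x0; exists (y, 0); [exact: sendograph0|exact: h].
by have [y y0 xy] := vu x x0; exists (y, 0); [exact: sendograph0|exact: h].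
Qed.

Lemma d_E_le e u v : 0 <= e -> level_close e u v -> d_E d (sval u) (sval v) <= e.
Proof.
move=> e0 uv; apply: (hausdorff_le dbar_ge0); [exact: endograph_nonempty..|].
split=> -[x a] [/= /andP[a0 a1] ax]; move: a0;
  rewrite le_eqVlt => /predU1P[a0|a0].
- by exists (x, 0); [exact: endograph0|rewrite -a0 dbar_refl].
- have [|+ _] := uv a; first by rewrite a0.
  move=> /(_ x ax)[y ay xy]; exists (y, a); first by split; rewrite //= ltW.
  by rewrite /dbar /= subrr normr0 ge_max xy.
- by exists (x, 0); [exact: endograph0|rewrite -a0 dbar_refl].
have [|_] := uv a; first by rewrite a0.
move=> /(_ x ax)[y ay xy]; exists (y, a); first by split; rewrite //= ltW.
by rewrite /dbar /= subrr normr0 ge_max xy.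
Qed.

Lemma d_S_le e u v : 0 <= e -> level_close e u v -> d_S d (sval u) (sval v) <= e.
Proof.
move=> e0 uv; apply/ler_addgt0Pr => delta delta0.
have ed : 0 <= e + delta by rewrite addr_ge0// ltW.
have half u' v' : (forall a, 0 < a <= 1 -> forall x, a <= sval u' x ->
      exists2 y, a <= sval v' y & d x y <= e) ->
    forall p, sendograph (sval u') p ->
      exists2 q, sendograph (sval v') q & dbar d p q <= e + delta.
  move=> h [x a] [[/= /andP[a0 a1] ax] [/= x0 _]].
  move: a0; rewrite le_eqVlt => /predU1P[a0|a0].
    have [y y0 xy] := level0_near delta0 x0.
    have [|z yz dyz] := h (sval u' y) _ y (lexx _); first by rewrite y0 fuzzy_le1.
    exists (z, 0).
      by apply/sendograph0/level0_pos; exact: lt_le_trans yz.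
    rewrite /dbar /= -a0 subrr normr0 ge_max ed andbT.
    by apply: le_trans (fmetric_triangle hd _ y _) _; rewrite addrC lerD// ltW.
  have [|y ay xy] := h a _ x ax; first by rewrite a0.
  exists (y, a); first exact: sendograph_pos.
  rewrite /dbar /= subrr normr0 ge_max ed andbT; apply: le_trans xy _.
  by rewrite lerDl ltW.
apply: (hausdorff_le dbar_ge0); [exact: sendograph_nonempty..|].
by split; apply: half => a /uv[].
Qed.

(** A point of grade [1] is compared with the points of positive grade, which are
    far in [X], and with those of grade [0], which are far in the grade. *)
Lemma d_E_ge e u v : e <= 1 ->
  (forall x y, 0 < sval u x -> 0 < sval v y -> e <= d x y) ->
  e <= d_E d (sval u) (sval v).
Proof.
move=> e1 h; have [x x1] := fuzzy_one u.
apply: (hausdorff_ge dbar_ge0 (endograph_within u v) (a := (x, 1))).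
- by split; rewrite //= lexx ler01.
- exact: endograph_nonempty.
move=> [y b] [/= /andP[b0 b1] by_]; rewrite /dbar/= le_max.
move: b0; rewrite le_eqVlt => /predU1P[<-|b0].
  by rewrite subr0 normr1 e1 orbT.
by rewrite h//; [exact: lt_le_trans x1|exact: lt_le_trans by_].
Qed.

Lemma d_S_ge e u v : e <= 1 ->
  (forall x y, 0 < sval u x -> 0 < sval v y -> e <= d x y) ->
  e <= d_S d (sval u) (sval v).
Proof.
move=> e1 h; have [x x1] := fuzzy_one u; have [M hM] := sendograph_within u v.
apply: (hausdorff_ge dbar_ge0 hM (a := (x, 1))).
- exact: sendograph_pos.
- exact: sendograph_nonempty.
move=> [y b] [[/= /andP[b0 b1] by_] _]; rewrite /dbar/= le_max.
move: b0; rewrite le_eqVlt => /predU1P[<-|b0].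
  by rewrite subr0 normr1 e1 orbT.
by rewrite h//; [exact: lt_le_trans x1|exact: lt_le_trans by_].
Qed.

End Fuzzy.

(** * Dynamics of the Zadeh extension *)

Section ZadehDynamics.
Context (R : realType) (K : numFieldType) (X : tvsType K) (d : X -> X -> R).
Context (hd : frechet_metric d) (T : {linear X -> X}) (hT : continuous T).
Implicit Types (u v w : fuzzy R X) (e a b : R).

Let That : fuzzy R X -> fuzzy R X := zadeh_map (frechet_hausdorff hd) hT.

Lemma iter_zadeh_level n u a : 0 < a ->
  [set x | a <= sval (iter n That u) x] = iter n T @` [set x | a <= sval u x].
Proof.
move=> a0; elim: n => [|n IH] /=; first by rewrite image_id.
rewrite (zadeh_level (frechet_hausdorff hd) hT (svalP _) a0).
by rewrite -/That IH image_comp.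
Qed.

Lemma iter_zadehP n u a x : 0 < a ->
  a <= sval (iter n That u) x <-> exists2 y, a <= sval u y & iter n T y = x.
Proof.
move=> a0; have /seteqP[h1 h2] := iter_zadeh_level n u a0.
by split; [exact: h1|exact: h2].
Qed.

Lemma iter_zadeh_ge n u x : sval u x <= sval (iter n That u) (iter n T x).
Proof.
have := fuzzy_ge0 u x; rewrite le_eqVlt => /predU1P[<-|ux]; first exact: fuzzy_ge0.
by apply/iter_zadehP => //; exists x.
Qed.

Lemma iter_zadeh_level0 n u x :
  level (sval u) 0 x -> level (sval (iter n That u)) 0 (iter n T x).
Proof.
rewrite /level eqxx => cx A /(iter_continuous hT) /cx[y [/= uy Ay]].
by exists (iter n T y); split=> //=; apply: lt_le_trans uy (iter_zadeh_ge n u y).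
Qed.

Lemma level_close_iter e (delta : R) n u v :
  (forall x y, d x y < delta -> d (iter n T x) (iter n T y) < e) ->
  (forall a, 0 < a <= 1 ->
    (forall x, a <= sval u x -> exists2 y, a <= sval v y & d x y < delta) /\
    (forall y, a <= sval v y -> exists2 x, a <= sval u x & d y x < delta)) ->
  level_close d e (iter n That u) (iter n That v).
Proof.
move=> h uv a a01; have /andP[a0 _] := a01.
rewrite !iter_zadeh_level//; apply: within_dist_iter h _.
exact: uv.
Qed.

Lemma equicontinuous_d_infty : equicontinuous_system d T ->
  equicontinuous_system (fuzzy_dist (d_infty d)) That.
Proof.
move=> heq e e0; have e20 : 0 < e / 2 by rewrite divr_gt0.
have [delta delta0 h] := heq _ e20; exists delta => // u v uv n n0.
apply: (@le_lt_trans _ _ (e / 2)); last by rewrite ltr_pdivrMr// ltr_pMr// ltr1n.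
apply: (d_infty_le hd); apply: (level_close_iter (fun x y xy => h x y xy n n0)).
by move=> a a01; exact: d_infty_lt.
Qed.

(** The reparametrization that matches [u] and [v] also matches their images,
    because the extension commutes with it. *)
Lemma equicontinuous_d_0 : equicontinuous_system d T ->
  equicontinuous_system (fuzzy_dist (d_0 d)) That.
Proof.
move=> heq e e0; have e20 : 0 < e / 2 by rewrite divr_gt0.
have [delta delta0 h] := heq _ e20.
exists (Num.min delta (e / 2)) => [|u v uv n n0]; first by rewrite lt_min delta0.
apply: (@le_lt_trans _ _ (e / 2)); last by rewrite ltr_pdivrMr// ltr_pMr// ltr1n.
have [r [r0 [xi [hxi xir uvr]]]] := inf_lt (d_0_nonempty hd u v) uv.
rewrite lt_min => /andP[rdelta re].
apply: (d_0_le_homeo hxi) => //; first exact: le_trans xir (ltW re).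
apply: (@d_infty_le _ _ _ _ hd _ _ (homeo_fuzzy hxi (iter n That v))) => a a01.
have [zeta hz _] := increasing_homeo_level hxi; have [za hza] := hz a a01.
have /andP[a0 _] := a01; have /andP[z0 _] := za.
have lev w : [set x | a <= sval (homeo_fuzzy hxi w) x] = [set x | zeta a <= sval w x].
  by apply/seteqP; split=> x /=; rewrite hza// fuzzy_ge0 fuzzy_le1.
rewrite lev !iter_zadeh_level// -lev.
apply: (within_dist_iter (fun x y xy => h x y xy n n0)).
apply: (d_infty_lt hd a01); exact: le_lt_trans uvr rdelta.
Qed.

Lemma equicontinuous_d_E : equicontinuous_system d T ->
  equicontinuous_system (fuzzy_dist (d_E d)) That.
Proof.
move=> heq e e0; have e20 : 0 < e / 2 by rewrite divr_gt0.
have [delta delta0 h] := heq _ e20.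
exists (Num.min delta (e / 2)) => [|u v uv n n0]; first by rewrite lt_min delta0.
apply: (@le_lt_trans _ _ (e / 2)); last by rewrite ltr_pdivrMr// ltr_pMr// ltr1n.
have half u' v' : (forall p, endograph (sval u') p -> exists2 q,
      endograph (sval v') q & dbar d p q < Num.min delta (e / 2)) ->
    forall p, endograph (sval (iter n That u')) p -> exists2 q,
      endograph (sval (iter n That v')) q & dbar d p q <= e / 2.
  move=> hp [x a] [/= /andP[a0 a1] ax]; move: a0; rewrite le_eqVlt => /predU1P[a0|a0].
    exists (x, 0); first exact: endograph0.
    by rewrite -a0 (dbar_refl hd) ltW.
  move/iter_zadehP: ax => /(_ a0)[y ay <-].
  have [|[z b] [/= b01 bz]] := hp (y, a); first by split; rewrite /= ?(ltW a0).
  rewrite /dbar gt_max !lt_min /= => /andP[/andP[yz _] /andP[_ ab]].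
  exists (iter n T z, b).
    by split=> //=; apply: le_trans bz (iter_zadeh_ge n v' z).
  by rewrite ge_max/= (ltW ab) andbT ltW// h.
have [uv1 uv2] := hausdorff_lt (dbar_ge0 hd) (endograph_nonempty u)
  (endograph_nonempty v) (endograph_within hd u v) uv.
apply: (hausdorff_le (dbar_ge0 hd)); [exact: endograph_nonempty..|].
by split; exact: half.
Qed.

(** At level [0] the endpoints of the sendograph are only limits of points of
    positive grade, which costs the extra [e / 4]. *)
Lemma equicontinuous_d_S : equicontinuous_system d T ->
  equicontinuous_system (fuzzy_dist (d_S d)) That.
Proof.
move=> heq e e0; have e20 : 0 < e / 2 by rewrite divr_gt0.
have e40 : 0 < e / 4 by rewrite divr_gt0.
have [delta delta0 h] := heq _ e20.
exists (Num.min delta (e / 2)) => [|u v uv n n0]; first by rewrite lt_min delta0.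
apply: (@le_lt_trans _ _ (e / 2 + e / 4)); last by lra.
have half u' v' : (forall p, sendograph (sval u') p -> exists2 q,
      sendograph (sval v') q & dbar d p q < Num.min delta (e / 2)) ->
    forall p, sendograph (sval (iter n That u')) p -> exists2 q,
      sendograph (sval (iter n That v')) q & dbar d p q <= e / 2 + e / 4.
  move=> hp.
  have key y a : sendograph (sval u') (y, a) -> exists2 q,
      sendograph (sval (iter n That v')) q & dbar d (iter n T y, a) q <= e / 2.
    move=> /hp[[z b] [[/= b01 bz] [/= z0 _]]].
    rewrite /dbar gt_max !lt_min /= => /andP[/andP[yz _] /andP[_ ab]].
    exists (iter n T z, b); last by rewrite ge_max/= (ltW ab) andbT ltW// h.
    split; first by split=> //=; apply: le_trans bz (iter_zadeh_ge n v' z).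
    by split=> /=; [exact: iter_zadeh_level0|rewrite in_itv].
  move=> [x a] [[/= /andP[a0 a1] ax] [/= x0 _]].
  move: a0; rewrite le_eqVlt => /predU1P[a0|a0]; last first.
    move/iter_zadehP: ax => /(_ a0)[y ay <-].
    have [q qv dq] := key _ _ (sendograph_pos a0 ay).
    by exists q => //; apply: le_trans dq _; rewrite lerDl ltW.
  have [x' x'0 xx'] := level0_near hd e40 x0.
  have := lexx (sval (iter n That u') x'); move/iter_zadehP => /(_ x'0)[y uy yx'].
  have [|q qv dq] := key y 0.
    by apply/sendograph0/level0_pos; exact: lt_le_trans uy.
  exists q => //; rewrite -a0; move: dq; rewrite yx' /dbar !ge_max/= => /andP[dq dq2].
  apply/andP; split; last by apply: le_trans dq2 _; rewrite lerDl ltW.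
  by apply: le_trans (fmetric_triangle hd _ x' _) _; rewrite addrC lerD// ltW.
have [M hM] := sendograph_within hd u v.
have [uv1 uv2] := hausdorff_lt (dbar_ge0 hd) (sendograph_nonempty u)
  (sendograph_nonempty v) hM uv.
apply: (hausdorff_le (dbar_ge0 hd)); [exact: sendograph_nonempty..|].
by split; exact: half.
Qed.

(** ** Fuzzy sets of finite support *)

Record finite_fuzzy := FiniteFuzzy {
  ff_supp : seq X ;
  ff_val : X -> R ;
  ff_val01 : forall x, 0 <= ff_val x <= 1 ;
  ff_val_out : forall x, x \notin ff_supp -> ff_val x = 0 ;
  ff_val_one : exists x, 1 <= ff_val x }.

Lemma finite_support_fuzzy (w : X -> R) (s : seq X) :
  (forall x, 0 <= w x <= 1) -> (forall x, x \notin s -> w x = 0) ->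
  (exists x, 1 <= w x) -> is_fuzzy w.
Proof.
move=> w01 ws w1.
have closed_seq (s' : seq X) : closed [set` s'].
  have /accessible_finite_set_closed h := hausdorff_accessible (frechet_hausdorff hd).
  by apply: h; exact: finite_seq.
split=> //.
- move=> x a wa; near=> y.
  have : ~ [set` [seq z <- s | z != x]] y.
    near: y; apply: open_nbhs_nbhs; split.
      by apply: closed_openC; exact: closed_seq.
    by rewrite /= mem_filter eqxx.
  rewrite /= mem_filter => /negP; rewrite negb_and negbK => /orP[/eqP->//|/ws->].
  by apply: le_lt_trans wa; have /andP[] := w01 x.
- apply: (subclosed_compact _ (finite_compact (finite_seq s))).
    by rewrite /level eqxx; exact: closed_closure.
  rewrite /level eqxx; apply: subset_trans (closed_seq s).
  apply: closureS => x /= wx; apply: contraTT wx => /ws->.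
  by rewrite ltxx.
by have [x x1] := w1; exists x; rewrite level_pos.
Unshelve. all: by end_near. Qed.

Lemma translate_fuzzy_subproof (w : finite_fuzzy) (z : X) :
  is_fuzzy (fun x => ff_val w (x - z)).
Proof.
apply: (@finite_support_fuzzy _ [seq x + z | x <- ff_supp w]).
- by move=> x; exact: ff_val01.
- move=> x hx; apply: ff_val_out; apply: contra hx => hx.
  by apply/mapP; exists (x - z); rewrite ?subrK.
by have [x x1] := ff_val_one w; exists (x + z); rewrite addrK.
Qed.

Definition fuzzy_translate (w : finite_fuzzy) z : fuzzy R X :=
  exist _ _ (translate_fuzzy_subproof w z).

(** The points of grade [1], on which the lower bounds rely. *)
Definition ff_core (w : finite_fuzzy) : seq X := [seq x <- ff_supp w | 1 <= ff_val w x].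

Lemma ff_suppP (w : finite_fuzzy) x : 0 < ff_val w x -> x \in ff_supp w.
Proof. by apply: contraTT => /ff_val_out ->; rewrite ltxx. Qed.

Lemma fuzzy_translate_close (w : finite_fuzzy) x y :
  level_close d (d x y) (fuzzy_translate w x) (fuzzy_translate w y).
Proof.
move=> a _; split=> z /= az.
  exists (z - x + y); first by rewrite addrK.
  by rewrite -{1}(subrK x z) (metric_addr hd).
exists (z - y + x); first by rewrite addrK.
by rewrite -{1}(subrK y z) (metric_addr hd) (fmetric_sym hd).
Qed.

Lemma iter_fuzzy_translateP n (w : finite_fuzzy) z a x : 0 < a ->
  a <= sval (iter n That (fuzzy_translate w z)) x <->
  exists2 y, y \in ff_supp w /\ a <= ff_val w y & x = iter n T (y + z).
Proof.
move=> a0; split=> [/(iter_zadehP _ _ _ a0)[y /= ay <-]|[y [_ ay] ->]].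
  exists (y - z); last by rewrite subrK.
  by split=> //; apply: ff_suppP; exact: lt_le_trans ay.
by apply/iter_zadehP => //; exists (y + z) => //=; rewrite addrK.
Qed.

Lemma iter_fuzzy_translate_close (b b' : finite_fuzzy) n x y e :
  d (iter n T x) 0 <= e -> d (iter n T y) 0 <= e ->
  (forall a : X, a \in ff_supp b -> d (iter n T a) 0 <= e) ->
  (forall a : X, a \in ff_supp b' -> d (iter n T a) 0 <= e) ->
  level_close d (4 * e) (iter n That (fuzzy_translate b x))
                        (iter n That (fuzzy_translate b' y)).
Proof.
have half (w w' : finite_fuzzy) x' y' a : d (iter n T x') 0 <= e ->
    d (iter n T y') 0 <= e ->
    (forall a : X, a \in ff_supp w -> d (iter n T a) 0 <= e) ->
    (forall a : X, a \in ff_supp w' -> d (iter n T a) 0 <= e) -> 0 < a <= 1 ->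
    forall z, a <= sval (iter n That (fuzzy_translate w x')) z ->
    exists2 z', a <= sval (iter n That (fuzzy_translate w' y')) z' & d z z' <= 4 * e.
  move=> hx hy hw hw' /andP[a0 a1] z /(iter_fuzzy_translateP _ _ _ _ a0)[c [cw ac] ->].
  have [c' c'1] := ff_val_one w'.
  have c'w : c' \in ff_supp w' by apply: ff_suppP; exact: lt_le_trans c'1.
  exists (iter n T (c' + y')).
    apply/iter_fuzzy_translateP => //; exists c' => //; split=> //.
    exact: le_trans c'1.
  by apply: (metric_orbit_le hd) => //; [exact: hw|exact: hw'].
by move=> hx hy hb hb' a a01; split; exact: half.
Qed.

Lemma iter_fuzzy_translate_core (b b' : finite_fuzzy) n x y e :
  (forall a a' : X, a \in ff_core b -> a' \in ff_core b' ->
     e <= d (iter n T (a + x)) (iter n T (a' + y))) ->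
  forall z z', 1 <= sval (iter n That (fuzzy_translate b x)) z ->
  1 <= sval (iter n That (fuzzy_translate b' y)) z' -> e <= d z z'.
Proof.
move=> h z z' /(iter_fuzzy_translateP _ _ _ _ ltr01)[c [cb c1] ->].
move=> /(iter_fuzzy_translateP _ _ _ _ ltr01)[c' [cb' c'1] ->].
by apply: h; rewrite mem_filter ?c1 ?c'1.
Qed.

(** An upper semicontinuous function stays away from a value which it does not
    reach on a compact set. *)
Lemma fuzzy_sup_attained u (C : set X) a : closed C -> 0 < a ->
  a <= sup [set sval u x | x in C] -> exists2 x, C x & a <= sval u x.
Proof.
move=> cC a0 ha; apply: contrapT => hno.
have ltC x : C x -> sval u x < a.
  by move=> Cx; rewrite ltNge; apply/negP => ax; apply: hno; exists x.
have [_ us _ _] := svalP u.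
pose L := [set x | a / 2 <= sval u x] `&` C.
have cL : compact L.
  apply: (subclosed_compact _ (level_compact (svalP u) (divr_gt0 a0 (ltr0n _ 2)))).
    by apply: closedI => //; exact: level_closed.
  by move=> x [].
have hL : \forall c \near a^'-, L `<=` [set x | sval u x < c].
  move/compact_near_coveringP: cL; apply => x [_ Cx].
  (* The midpoint leaves room both for [u] near [x] and for the levels near [a]. *)
  have mid : sval u x < (sval u x + a) / 2 < a by have := ltC x Cx; lra.
  have /andP[m1 m2] := mid.
  exists ([set y | sval u y < (sval u x + a) / 2], [set c | (sval u x + a) / 2 < c]).
    by split; [exact: us|exact: nbhs_left_gt].
  by move=> [y c] /= [yx xc]; exact: lt_trans yx xc.
have ha2 : \forall c \near a^'-, a / 2 < c.
  by apply: nbhs_left_gt; rewrite ltr_pdivrMr// ltr_pMr// ltr1n.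
have hca : \forall c \near a^'-, c < a by exact: nbhs_left_lt.
have [c [[cL' c2] ca]] := filter_ex (filterI (filterI hL ha2) hca).
suff : sup [set sval u x | x in C] <= c by rewrite leNgt (lt_le_trans ca ha).
have [[x0 Cx0]|C0] := pselect (C !=set0); last first.
  suff -> : [set sval u x | x in C] = set0 by rewrite sup0 ltW// (lt_trans _ c2)// divr_gt0.
  by apply/seteqP; split=> // y [x Cx _]; apply: C0; exists x.
apply: ge_sup; first by exists (sval u x0), x0.
move=> _ [x Cx <-]; have [ax|ax] := leP (a / 2) (sval u x).
  by apply/ltW/cL'.
by apply/ltW; exact: lt_trans ax c2.
Qed.

End ZadehDynamics.

(** * Chaos of the operator and of its hyperspace extension *)

Section OperatorChaos.
Context (R : realType) (K : numFieldType) (X : tvsType K) (d : X -> X -> R).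
Context (hd : frechet_metric d) (T : {linear X -> X}) (hT : continuous T).
Context (p : nat -> nat) (hp : increasing_positive p).
Context (hexp : expanding_on d T (null_along T p)).

Lemma operator_U_LYC : U_LYC d T.
Proof.
apply: (U_LYC_of_embedding hd hT hp hexp (fmetric_ge0 hd) (metric_refl hd)
  (phi := id)) => [n x y e _ //|n x y e hx hy].
have h0 : d (iter n T 0) 0 <= e.
  by rewrite iter_linear0 (metric_refl hd); apply: le_trans hx; exact: (fmetric_ge0 hd).
by have := metric_orbit_le hd hx hy h0 h0; rewrite !add0r.
Qed.

Lemma operator_CD_LYC : dense (null_along T p) -> CD_LYC d T.
Proof.
move=> dp; apply: (CD_LYC_of_translates hd hT hp hexp (fmetric_ge0 hd)
  (metric_refl hd) (core := fun b : X => [:: b]) (supp := fun b : X => [:: b])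
  (phi := fun b x => b + x)).
- by move=> b x y; rewrite (metric_addr hd).
- by move=> b b' n x y e; apply; exact: mem_head.
- move=> b b' n x y e hx hy hb hb'.
  by apply: (metric_orbit_le hd) => //; [apply: hb|apply: hb']; exact: mem_head.
move=> U oU [y Uy]; have [r r0 hr] := oU y Uy.
have r20 : 0 < r / 2 by rewrite divr_gt0.
have [b bp yb] := dense_metric hd dp y r20.
exists b, (r / 2); split=> // [a|x xr]; first by rewrite inE => /eqP->.
apply: hr => /=; apply: le_lt_trans (fmetric_triangle hd _ b _) _.
by rewrite [ltRHS]splitr ltrD// (fmetric_sym hd) (metric_sub hd) addrAC subrr add0r.
Qed.

Lemma hyper_U_LYC : U_LYC (hyper_dist d) (hyper_map hT).
Proof.
apply: (U_LYC_of_embedding hd hT hp hexp (hyper_dist_ge0 hd) (hyper_dist_refl hd)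
  (phi := hyper_translate (0, [::]))) => [n x y e _ hxy|n x y e hx hy].
  apply: (hyper_translate_ge hd) => a a'; rewrite !inE => /eqP-> /eqP->.
  by rewrite !add0r.
by apply: (hyper_translate_le hd) => // a; rewrite inE => /eqP->;
  rewrite iter_linear0 (metric_refl hd); apply: le_trans hx; exact: (fmetric_ge0 hd).
Qed.

Lemma hyper_CD_LYC :
  dense (null_along T p) -> CD_LYC (hyper_dist d) (hyper_map hT).
Proof.
move=> dp; apply: (CD_LYC_of_translates hd hT hp hexp (hyper_dist_ge0 hd)
  (hyper_dist_refl hd) (core := fun b : X * seq X => b.1 :: b.2)
  (supp := fun b : X * seq X => b.1 :: b.2) (phi := @hyper_translate K X)).
- exact: hyper_translate_lip.
- by move=> *; exact: hyper_translate_ge.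
- by move=> *; exact: hyper_translate_le.
by move=> U; exact: hyper_translate_dense.
Qed.

End OperatorChaos.

(** * Chaos of the Zadeh extension *)

Section Singleton.
Context (R : realType) (K : numFieldType) (X : tvsType K).

Let g (x : X) : R := (x == 0)%:R.

Let g01 x : 0 <= g x <= 1.
Proof. by rewrite /g; case: eqP; rewrite ?lexx ?ler01. Qed.

Let gout x : x \notin [:: 0] -> g x = 0.
Proof. by rewrite inE /g => /negbTE->. Qed.

Let g1 : exists x, 1 <= g x.
Proof. by exists 0; rewrite /g eqxx. Qed.

Definition ff_singleton : finite_fuzzy R X := FiniteFuzzy g01 gout g1.

End Singleton.

Section ZadehChaos.
Context (R : realType) (K : numFieldType) (X : tvsType K) (d : X -> X -> R).
Context (hd : frechet_metric d) (T : {linear X -> X}) (hT : continuous T).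

Let That : fuzzy R X -> fuzzy R X := zadeh_map (frechet_hausdorff hd) hT.

(** The grade of a point of the net is the largest grade found in its closed
    ball.  This makes all the level sets approximate at once. *)
Lemma finite_fuzzy_approx (u : fuzzy R X) (E : set X) (e : R) : dense E -> 0 < e ->
  exists w : finite_fuzzy R X, (forall x, x \in ff_supp w -> E x) /\
    level_close d e u (fuzzy_translate hd w 0).
Proof.
move=> dE e0; have [u01 _ cu _] := svalP u.
have [xs [xsE uxs _]] := compact_net hd cu dE e0.
pose ball x := [set y | d y x <= e].
have closed_ball x : closed (ball x).
  move=> y cy; apply/ler_addgt0Pr => delta delta0.
  have [y' [/= y'x yy']] := cy _ (metric_ball_nbhs hd y delta0).
  by apply: le_trans (fmetric_triangle hd _ y' _) _; rewrite addrC lerD// ltW.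
pose g x := if x \in xs then sup [set sval u y | y in ball x] else 0.
have ub x : has_ubound [set sval u y | y in ball x].
  by exists 1 => _ [y _ <-]; exact: fuzzy_le1.
have g_ge x y : x \in xs -> d y x <= e -> sval u y <= g x.
  by move=> xxs yx; rewrite /g xxs; apply: ub_le_sup; [exact: ub|exists y].
have g01 x : 0 <= g x <= 1.
  rewrite /g; case: ifP => _; last by rewrite lexx ler01.
  rewrite sup_ge0; last by move=> _ [y _ <-]; exact: fuzzy_ge0.
  apply: ge_sup; last by move=> _ [y _ <-]; exact: fuzzy_le1.
  by exists (sval u x), x => //; rewrite /ball /= (metric_refl hd) ltW.
have near_xs a y : 0 < a -> a <= sval u y -> exists2 x, x \in xs &
    a <= g x /\ d y x <= e.
  move=> a0 ay; have [|x xxs yx] := uxs y.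
    by apply: level0_pos; exact: lt_le_trans ay.
  by exists x => //; split; [apply: le_trans ay _; apply: g_ge|]; rewrite // ltW.
have g1 : exists x, 1 <= g x.
  have [y y1] := fuzzy_one u; have [x _ [gx _]] := near_xs 1 y ltr01 y1.
  by exists x.
have gout x : x \notin xs -> g x = 0 by rewrite /g => /negbTE->.
exists (FiniteFuzzy g01 gout g1); split=> // a /andP[a0 a1]; split=> y /= ay.
  by have [x _ [gx yx]] := near_xs a y a0 ay; exists x => //; rewrite subr0.
rewrite subr0 in ay; have [yxs|yxs] := boolP (y \in xs); last first.
  by move: ay; rewrite gout// leNgt a0.
rewrite /g yxs in ay; have [x yx ux] := fuzzy_sup_attained (closed_ball y) a0 ay.
by exists x; rewrite // (fmetric_sym hd).
Qed.

Context (D : (X -> R) -> (X -> R) -> R).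
Context (D_ge0 : forall u v : fuzzy R X, 0 <= D (sval u) (sval v)).
Context (D_le : forall e (u v : fuzzy R X), 0 <= e -> level_close d e u v ->
  D (sval u) (sval v) <= e).

Lemma fuzzy_dist_refl (u : fuzzy R X) : fuzzy_dist D u u = 0.
Proof.
apply/eqP; rewrite eq_le D_ge0 andbT; apply: D_le => //.
exact: level_close_refl.
Qed.

Lemma fuzzy_translate_le (b b' : finite_fuzzy R X) n x y e :
  d (iter n T x) 0 <= e -> d (iter n T y) 0 <= e ->
  (forall a : X, a \in ff_supp b -> d (iter n T a) 0 <= e) ->
  (forall a : X, a \in ff_supp b' -> d (iter n T a) 0 <= e) ->
  fuzzy_dist D (iter n That (fuzzy_translate hd b x))
               (iter n That (fuzzy_translate hd b' y)) <= 4 * e.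
Proof.
move=> hx hy hb hb'; apply: D_le; last exact: iter_fuzzy_translate_close.
by rewrite mulr_ge0//; apply: le_trans hx; exact: (fmetric_ge0 hd).
Qed.

Context (p : nat -> nat) (hp : increasing_positive p).
Context (hexp : expanding_on d T (null_along T p)).

Lemma fuzzy_U_LYC :
  (forall e (u v : fuzzy R X), e <= 1 ->
    (forall x y, 0 < sval u x -> 0 < sval v y -> e <= d x y) ->
    e <= D (sval u) (sval v)) ->
  U_LYC (fuzzy_dist D) That.
Proof.
move=> D_ge.
apply: (U_LYC_of_embedding hd hT hp hexp (fun u v => D_ge0 u v) fuzzy_dist_refl
  (phi := fuzzy_translate hd (ff_singleton R X))).
  move=> n x y e e1 exy; apply: D_ge => // z z' zp zp'.
  have := lexx (sval (iter n That (fuzzy_translate hd (ff_singleton R X) x)) z).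
  move=> /(iter_fuzzy_translateP _ _ _ _ _ _ zp)[c [/= + _] ->].
  have := lexx (sval (iter n That (fuzzy_translate hd (ff_singleton R X) y)) z').
  move=> /(iter_fuzzy_translateP _ _ _ _ _ _ zp')[c' [/= + _] ->].
  by rewrite !inE => /eqP-> /eqP->; rewrite !add0r.
move=> n x y e hx hy; apply: fuzzy_translate_le => // a; rewrite inE => /eqP->;
  by rewrite iter_linear0 (metric_refl hd); apply: le_trans hx; exact: (fmetric_ge0 hd).
Qed.

Lemma fuzzy_CD_LYC : dense (null_along T p) ->
  (forall e (u v : fuzzy R X),
    (forall x y, 1 <= sval u x -> 1 <= sval v y -> e <= d x y) ->
    e <= D (sval u) (sval v)) ->
  CD_LYC (fuzzy_dist D) That.
Proof.
move=> dp D_ge.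
apply: (CD_LYC_of_translates hd hT hp hexp (fun u v => D_ge0 u v) fuzzy_dist_refl
  (core := @ff_core _ _ _) (supp := @ff_supp _ _ _) (phi := fuzzy_translate hd)).
- move=> b x y; apply: D_le; first exact: (fmetric_ge0 hd).
  exact: fuzzy_translate_close.
- by move=> b b' n x y e h; apply: D_ge; exact: iter_fuzzy_translate_core.
- by move=> b b' n x y e; exact: fuzzy_translate_le.
move=> U oU [u Uu]; have [r r0 hr] := oU u Uu.
have r30 : 0 < r / 3 by rewrite divr_gt0.
have [w [wE uw]] := finite_fuzzy_approx u dp r30.
exists w, (r / 3); split=> // x xr; apply: hr.
apply: (@le_lt_trans _ _ (r / 3 + d 0 x)).
  apply: D_le; first by rewrite addr_ge0 ?(fmetric_ge0 hd)// ltW.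
  by apply: (level_close_trans hd) uw _; exact: fuzzy_translate_close.
by rewrite (fmetric_sym hd); move: xr; move: (d _ _) => ?; lra.
Qed.

End ZadehChaos.

Theorem theorem5p5 (R : realType) (K : numFieldType)
    (hK : K = R :> numFieldType \/ K = R[i] :> numFieldType)
    (X : tvsType K) (d : X -> X -> R) (hd : frechet_metric d)
    (T : {linear X -> X}) (hT : continuous T) :
  (dense (linear_span (NS T)) ->
    let That := @zadeh_map R X T (frechet_hausdorff hd) hT in
    [<-> ~ equicontinuous_system d T;
         U_LYC d T;
         U_LYC (hyper_dist d) (hyper_map hT);
         U_LYC (fuzzy_dist (d_infty d)) That;
         U_LYC (fuzzy_dist (d_0 d)) That;
         U_LYC (fuzzy_dist (d_S d)) That;
         U_LYC (fuzzy_dist (d_E d)) That]) /\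
  ((exists2 s : nat -> nat, increasing_positive s &
      dense [set x : X | (fun k => iter (s k) T x) @ \oo --> (0 : X)]) ->
    let That := @zadeh_map R X T (frechet_hausdorff hd) hT in
    [<-> ~ equicontinuous_system d T;
         CD_LYC d T;
         CD_LYC (hyper_dist d) (hyper_map hT);
         CD_LYC (fuzzy_dist (d_infty d)) That;
         CD_LYC (fuzzy_dist (d_0 d)) That;
         U_LYC (fuzzy_dist (d_S d)) That;
         U_LYC (fuzzy_dist (d_E d)) That]).
Proof.
have dinf_le (e : R) (u v : fuzzy R X) : 0 <= e -> level_close d e u v ->
    d_infty d (sval u) (sval v) <= e by move=> _; exact: (d_infty_le hd).
have weaken (D : (X -> R) -> (X -> R) -> R) :
    (forall e (u v : fuzzy R X),
      (forall x y, 1 <= sval u x -> 1 <= sval v y -> e <= d x y) ->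
      e <= D (sval u) (sval v)) ->
    forall e (u v : fuzzy R X), e <= 1 ->
      (forall x y, 0 < sval u x -> 0 < sval v y -> e <= d x y) ->
      e <= D (sval u) (sval v).
  move=> hD e u v _ h; apply: hD => x y x1 y1.
  by apply: h; [exact: lt_le_trans x1|exact: lt_le_trans y1].
have inhK : hyperspace X := hyper_translate (0, [::]) 0.
have inhF : fuzzy R X := fuzzy_translate hd (ff_singleton R X) 0.
pose That := @zadeh_map R X T (frechet_hausdorff hd) hT.
have neqS : U_LYC (fuzzy_dist (d_S d)) That -> ~ equicontinuous_system d T.
  move=> /U_LYC_not_equicontinuous; apply: contra_not.
  exact: equicontinuous_d_S.
have neqE : U_LYC (fuzzy_dist (d_E d)) That -> ~ equicontinuous_system d T.
  move=> /U_LYC_not_equicontinuous; apply: contra_not.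
  exact: equicontinuous_d_E.
have toS p : increasing_positive p -> expanding_on d T (null_along T p) ->
    U_LYC (fuzzy_dist (d_S d)) That.
  move=> hp hexp.
  exact: (fuzzy_U_LYC hd hT (d_S_ge0 hd) (d_S_le hd) hp hexp (d_S_ge hd)).
have toE p : increasing_positive p -> expanding_on d T (null_along T p) ->
    U_LYC (fuzzy_dist (d_E d)) That.
  move=> hp hexp.
  exact: (fuzzy_U_LYC hd hT (d_E_ge0 hd) (d_E_le hd) hp hexp (d_E_ge hd)).
split=> [dNS|[s hs ds]].
  have hex : ~ equicontinuous_system d T ->
      exists2 p, increasing_positive p & expanding_on d T (null_along T p).
    exact: expanding_of_dense_span.
  tfae.
  - by move=> /hex[p hp hexp]; exact: (operator_U_LYC hd hT hp hexp).
  - move=> /U_LYC_not_equicontinuous/hex[p hp hexp].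
    exact: (hyper_U_LYC hd hT hp hexp).
  - move=> /U_LYC_not_equicontinuous/(contra_not (equicontinuous_hyper hd hT)).
    move=> /hex[p hp hexp].
    exact: (fuzzy_U_LYC hd hT (d_infty_ge0 hd) dinf_le hp hexp
      (weaken _ (d_infty_ge hd))).
  - move=> /U_LYC_not_equicontinuous/(contra_not (equicontinuous_d_infty hd hT)).
    move=> /hex[p hp hexp].
    exact: (fuzzy_U_LYC hd hT (d_0_ge0 hd) (d_0_le hd) hp hexp
      (weaken _ (d_0_ge hd))).
  - move=> /U_LYC_not_equicontinuous/(contra_not (equicontinuous_d_0 hd hT)).
    by move=> /hex[p hp hexp]; exact: toS hp hexp.
  - by move=> /neqS/hex[p hp hexp]; exact: toE hp hexp.
  - exact: neqE.
have hex : ~ equicontinuous_system d T -> expanding_on d T (null_along T s).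
  exact: expanding_of_dense.
tfae.
- by move=> /hex hexp; exact: (operator_CD_LYC hd hT hs hexp ds).
- move=> /(CD_LYC_not_equicontinuous 0)/hex hexp.
  exact: (hyper_CD_LYC hd hT hs hexp ds).
- move=> /(CD_LYC_not_equicontinuous inhK).
  move=> /(contra_not (equicontinuous_hyper hd hT))/hex hexp.
  exact: (fuzzy_CD_LYC hd hT (d_infty_ge0 hd) dinf_le hs hexp ds (d_infty_ge hd)).
- move=> /(CD_LYC_not_equicontinuous inhF).
  move=> /(contra_not (equicontinuous_d_infty hd hT))/hex hexp.
  exact: (fuzzy_CD_LYC hd hT (d_0_ge0 hd) (d_0_le hd) hs hexp ds (d_0_ge hd)).
- move=> /(CD_LYC_not_equicontinuous inhF).
  by move=> /(contra_not (equicontinuous_d_0 hd hT))/hex hexp; exact: toS hs hexp.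
- by move=> /neqS/hex hexp; exact: toE hs hexp.
exact: neqE.
Qed.
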